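(* Let $\ell\in\mathbb N^*$. Let $\mathbf p$ be an offspring distribution with $\mathbf p(0)+\mathbf p(1)<1$, with finite mean $\mu$, and admitting a moment of order $\ell$ (i.e. $\sum_k k^\ell\mathbf p(k)<\infty$), and let $\mathbf q$ be a mark function such that $\mathbf p(k)\mathbf q(k)>0$ for some $k\in\mathbb N$. Let $\mathbb P$ be the distribution of the marked Galton-Watson tree with offspring distribution $\mathbf p$ and mark function $\mathbf q$. Then, for every $n\in\mathbb N$ and every $\Lambda_n\in\mathscr F_n$: (i) if $\mu<1$, $$\lim_{p\to+\infty}\frac{\mathbb E[\mathbf 1_{\Lambda_n}M_{n+p}^\ell]}{\mathbb E[M_{n+p}^\ell]}=\mathbb E[\mathbf 1_{\Lambda_n}f_\ell(M_n,Z_n)],$$ where for $s,z\in\mathbb N$ $$f_\ell(s,z)=\frac1{\xi_\ell}\sum_{i=0}^{\ell}\binom{\ell}{i}s^{\ell-i}\sum_{t_1+\cdots+t_z=i}\binom{i}{t_1\cdots t_z}\prod_{j=1}^z\xi_{t_j},\qquad \xi_j=\lim_{p\to+\infty}\mathbb E[M_p^j];$$ (ii) if $\mu=1$, $$\lim_{p\to+\infty}\frac{\mathbb E[\mathbf 1_{\Lambda_n}M_{n+p}^\ell]}{\mathbb E[M_{n+p}^\ell]}=\mathbb E[\mathbf 1_{\Lambda_n}Z_n];$$ (iii) if $\mu>1$, there is a polynomial function $P_\ell$ of degree $\ell$ (depending only on $\mathbf p,\mathbf q,\ell$, not on $n$ or $\Lambda_n$) such that $$\lim_{p\to+\infty}\frac{\mathbb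 E[\mathbf 1_{\Lambda_n}M_{n+p}^\ell]}{\mathbb E[M_{n+p}^\ell]}=\mathbb E\left[\mathbf 1_{\Lambda_n}\frac{P_\ell(Z_n)}{\mu^{\ell n}}\right].$$
   Context: $\mathbb N=\{0,1,2,\dots\}$, $\mathbb N^*=\{1,2,\dots\}$. Let $\mathscr U=\bigcup_{n\ge0}(\mathbb N^* )^n$ be the set of finite sequences of positive integers, $|u|$ the length of $u$, $\emptyset$ the empty sequence. A tree $\mathbf t$ is a subset of $\mathscr U$ such that $\emptyset\in\mathbf t$; $uj\in\mathbf t\Rightarrow u\in\mathbf t$ (for $j\in\mathbb N^*$); and for each $u\in\mathbf t$ there is $k_u(\mathbf t)\in\mathbb N$ (number of children) with $ui\in\mathbf t\iff i\le k_u(\mathbf t)$. A marked tree is $\mathbf t^*=(\mathbf t,(\eta_u)_{u\in\mathbf t})$ with $\eta_u\in\{0,1\}$; $u$ is marked if $\eta_u=1$; $\mathbb T^*$ is the set of marked trees. For $n\in\mathbb N$, $r_n^*(\mathbf t^* )$ is the marked tree consisting of the nodes $u\in\mathbf t$ with $|u|\le n$, keeping the marks of nodes with $|u|\le n-1$ and setting the marks at level $n$ to $0$. $\mathscr F_n$ is the $\sigma$-field on $\mathbb T^*$ generated by $r_n^*$, and $\mathscr F=\bigvee_n\mathscr F_n$. $Z_n(\mathbf t^* )$ is the number of nodes $u\in\mathbf t$ with $|u|=n$; $M_0=0$ and $M_n(\mathbf t^* )=\sum_{u\in\mathbf t,|u|\le n-1}\eta_u$ for $n\ge1$. An offspring distribution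 is a probability distribution $\mathbf p=(\mathbf p(k))_{k\in\mathbb N}$ on $\mathbb N$, with mean $\mu$; a mark function is a map $\mathbf q:\mathbb N\to[0,1]$. Set $\mathbf p_0(k,1)=\mathbf p(k)\mathbf q(k)$, $\mathbf p_0(k,0)=\mathbf p(k)(1-\mathbf q(k))$. The marked Galton-Watson tree distribution $\mathbb P$ is the unique probability measure on $(\mathbb T^*,\mathscr F)$ such that, with $\tau^*$ the identity map of $\mathbb T^*$, for all $h\ge1$ and $\mathbf t^*\in\mathbb T^*$, $\mathbb P(r_h^*(\tau^* )=r_h^*(\mathbf t^* ))=\prod_{u\in\mathbf t,|u|\le h-1}\mathbf p_0(k_u(\mathbf t),\eta_u)$. $\mathbb E$ is the expectation under $\mathbb P$, and $Z_n=Z_n(\tau^* )$, $M_n=M_n(\tau^* )$. In the sums, $t_1,\dots,t_z$ range over $\mathbb N$; $\binom{i}{t_1\cdots t_z}$ is the multinomial coefficient; $0^0=1$; and $f_\ell(s,0)=s^\ell/\xi_\ell$. *)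

(* Defs.v *)
From HB Require Import structures.
From mathcomp Require Import all_boot all_order all_algebra.
From mathcomp Require Import finmap all_classical all_reals all_analysis.
Set Implicit Arguments.
Unset Strict Implicit.
Unset Printing Implicit Defensive.
Import Order.TTheory GRing.Theory Num.Theory.
Import numFieldNormedType.Exports.
Local Open Scope classical_set_scope.
Local Open Scope ring_scope.

Definition words : set (seq nat) := [set u | all (fun i => 0 < i)%N u].

Record is_tree (t : set (seq nat)) : Prop := IsTree {
  tree_words : t `<=` words;
  tree_root : t [::];
  tree_parent : forall u j, t (rcons u j) -> t u;
  tree_children : forall u, t u ->
    exists k, forall i, (0 < i)%N -> (t (rcons u i) <-> (i <= k)%N) }.

(* The marks (eta_u) are indexed by the nodes; the total function [mark] is
   required to vanish off the tree, so that equality of records is equality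
   of marked trees. *)
Record marked_tree := MarkedTree {
  nodes : set (seq nat);
  mark : seq nat -> bool;
  nodes_tree : is_tree nodes;
  mark_nodes : forall u, mark u -> nodes u }.

(* k_u(t), characterized as in [tree_children]. *)
Definition nchildren (t : set (seq nat)) (u : seq nat) : nat :=
  xget 0%N [set k | forall i, (0 < i)%N -> (t (rcons u i) <-> (i <= k)%N)].

Lemma is_tree_root : is_tree [set [::]].
Proof.
split=> //.
- by move=> _ ->.
- by move=> [|? ?] ?.
- move=> _ ->; exists 0%N => i i_gt0; split => //.
  by rewrite leqNgt i_gt0.
Qed.

Definition root_tree : marked_tree :=
  @MarkedTree [set [::]] (fun=> false) is_tree_root
    (fun u (mark_u : false) => False_ind _ (notF mark_u)).

HB.instance Definition _ := gen_eqMixin marked_tree.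
HB.instance Definition _ := gen_choiceMixin marked_tree.
HB.instance Definition _ := isPointed.Build marked_tree root_tree.

Definition restr_nodes (n : nat) (t : marked_tree) : set (seq nat) :=
  [set u | nodes t u /\ (size u <= n)%N].

Definition restr_mark (n : nat) (t : marked_tree) (u : seq nat) : bool :=
  mark t u && (size u < n)%N.

Lemma restr_is_tree n t : is_tree (restr_nodes n t).
Proof.
have [tW t0 tp tc] := nodes_tree t; split.
- by move=> u [/tW].
- by split.
- move=> u j [/tp tu]; rewrite size_rcons => /ltnW un; by split.
- move=> u [/tc [k tk] _]; have [un|un] := ltnP (size u) n.
    exists k => i /tk [h1 h2]; split=> [[/h1]//|/h2]; split=> //.
    by rewrite size_rcons.
  exists 0%N => i i_gt0; split=> [[_]|]; last by rewrite leqNgt i_gt0.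
  by rewrite size_rcons ltnNge un.
Qed.

Lemma restr_mark_nodes n t u : restr_mark n t u -> restr_nodes n t u.
Proof. by case/andP=> /mark_nodes tu /ltnW un; split. Qed.

Definition restr (n : nat) (t : marked_tree) : marked_tree :=
  MarkedTree (restr_is_tree n t) (@restr_mark_nodes n t).

(* [restr n] takes countably many values, and the sigma-field it generates is
   the one pulled back from the discrete sigma-field on marked trees. *)
Definition Fn (n : nat) : set (set marked_tree) :=
  preimage_set_system setT (restr n) setT.

Definition mtree_space := g_sigma_algebraType (\bigcup_n Fn n).

Definition Z (n : nat) (t : marked_tree) : nat :=
  (#|` fset_set [set u | nodes t u /\ size u = n]|)%fset.

Definition M (n : nat) (t : marked_tree) : nat :=
  \sum_(u \in [set u | nodes t u /\ (size u < n)%N]) (mark t u : nat).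

Record offspring_distribution (R : realType) (p : nat -> R) : Prop := {
  offspring_ge0 : forall k, 0 <= p k;
  offspring_sum1 : (\sum_(0 <= k <oo) (p k)%:E = 1)%E }.

Definition moment (R : realType) (p : nat -> R) (l : nat) : \bar R :=
  (\sum_(0 <= k <oo) (k%:R ^+ l * p k)%:E)%E.

Definition mark_function (R : realType) (q : nat -> R) : Prop :=
  forall k, 0 <= q k <= 1.

Definition p0 (R : realType) (p q : nat -> R) (k : nat) (e : bool) : R :=
  if e then p k * q k else p k * (1 - q k).

(* This property determines P uniquely. *)
Definition marked_GW (R : realType) (p q : nat -> R)
    (P : probability mtree_space R) : Prop :=
  forall (h : nat) (t : marked_tree), (0 < h)%N ->
    P [set tau : mtree_space | restr h tau = restr h t] =
    (\big[*%R/1]_(u \in [set u | nodes t u /\ (size u < h)%N])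
       p0 p q (nchildren (nodes t) u) (mark t u))%:E.

Section penalization.
Context (R : realType) (P : probability mtree_space R).
Local Open Scope ereal_scope.

Definition Mmoment (l n : nat) : \bar R := 'E_P[(fun tau => (M n tau)%:R ^+ l)%R].

(* Division in \bar R: 0^-1 = +oo, +oo^-1 = 0. *)
Definition penalized_ratio (l n : nat) (A : set mtree_space) (p : nat) : \bar R :=
  'E_P[(fun tau => \1_A tau * (M (n + p)%N tau)%:R ^+ l)%R] /
  Mmoment l (n + p)%N.

Definition xi (j : nat) : R := fine (limn (Mmoment j)).

Local Open Scope ring_scope.

Definition multinomial (i z : nat) (t : 'I_z -> nat) : R :=
  i`!%:R / \prod_(j < z) (t j)`!%:R.

(* The constraint t_1 + ... + t_z = i forces t_j <= i, hence the finite range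
   'I_i.+1 of the t_j. *)
Definition f (l s z : nat) : R :=
  (xi l)^-1 * \sum_(i < l.+1) 'C(l, i)%:R * s%:R ^+ (l - i) *
    \sum_(t : {ffun 'I_z -> 'I_i.+1} | (\sum_(j < z) t j == i)%N)
      multinomial i (fun j => t j) * \prod_(j < z) xi (t j).

End penalization.

(* Main.v *)
(* The pair (M_n, Z_n) is a Markov chain for (F_n): given F_n, the pairs (number
   of children, mark) of the nodes at height n are i.i.d. with law p0.  Hence, on
   F_n, the exponential generating function e^(sM) E(s)^Z of (M_(n+1), Z_(n+1))
   has the same conditional expectation, up to degree l in s, as e^(sM) (TE)(s)^Z
   at time n, where T is the operator TE = sum_(k,b) p0(k,b) e^(sb) E^k.
   Iterating, E[M_k^j] / j! is the coefficient of degree j of T^k 1 = 1 + N_k, and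
     E[1_A M_(n+k)^l] / l!
       = sum_(a <= i <= l) [s^i] N_k^a E[1_A M_n^(l-i) / (l-i)! binomial(Z_n, a)]
   is a finite sum, so that only the growth of the coefficients of N_k matters.
   They satisfy N_(k+1,j) = mu N_(k,j) + (polynomial in N_(k,1), ..., N_(k,j-1)),
   whence, by induction on j, N_(k,j) converges if mu < 1, and is of order
   k^(2j-1) if mu = 1 and mu^(jk) if mu > 1. *)
Require Import Defs.
From HB Require Import structures.
From mathcomp Require Import all_boot all_order all_algebra.
From mathcomp Require Import finmap all_classical all_reals all_analysis.
From mathcomp Require Import measurable_realfun.
From mathcomp Require Import zify ring.
Set Implicit Arguments.
Unset Strict Implicit.
Unset Printing Implicit Defensive.
Import Order.TTheory GRing.Theory Num.Theory.
Import numFieldNormedType.Exports.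
Local Open Scope classical_set_scope.
Local Open Scope ring_scope.

(** * Marked trees and their levels *)

(** Only a moment of order l is available, so generating functions cannot be treated as convergent
    series. Since E has constant term 1, E - 1 is nilpotent modulo degree l + 1: E^k expands in
    powers of E - 1 over a range independent of k, and T only involves binomial moments of order at
    most l. All coefficients are nonnegative, so series and integrals are exchanged in [\bar R]
    without prior integrability. The three growth rates share the form lam_k^j kap_k, with (lam_k,
    kap_k) equal to (1, 1), ((k+1)^2, 1/(k+1)) or (mu^k, 1) for mu < 1, mu = 1, mu > 1. In degree i,
    N_k^a then has scale lam_k^i kap_k^a, and comparison with lam_k^l kap_k tells which terms
    survive: a growing lam kills i < l, a vanishing kap kills a > 1. This yields the full sum f_l,
    the single term Z_n, and a polynomial in Z_n. The ratio makes sense in the limit only if the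
    normalized coefficients have positive limits. The source of positivity is a marked node
    (p(k)q(k) > 0 for some k) and, where the marks fade at the chosen scale, the quadratic term of T
    (p(0) + p(1) < 1). *)

Lemma marked_treeP (s t : marked_tree) :
  nodes s = nodes t -> mark s =1 mark t -> s = t.
Proof.
case: s t => [ns ms ts hs] [nt mt tt ht] /= eqn /funext eqm.
by subst; rewrite (Prop_irrelevance ts tt) (Prop_irrelevance hs ht).
Qed.

Lemma nchildrenP (t : set (seq nat)) u : is_tree t -> t u ->
  forall i, (0 < i)%N -> (t (rcons u i) <-> (i <= nchildren t u)%N).
Proof.
by move=> /tree_children tc /tc tu; exact: (xgetPex 0%N tu).
Qed.

Lemma nchildrenE (t : set (seq nat)) u k :
  (forall i, (0 < i)%N -> (t (rcons u i) <-> (i <= k)%N)) -> nchildren t u = k.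
Proof.
move=> tk; rewrite /nchildren; case: xgetP => [m _ /= tm|/(_ k)/(_ tk)//].
apply/eqP; rewrite eqn_leq; apply/andP; split.
  by case: m tm => // m tm; apply/tk => //; apply/tm.
by case: k tk => // k tk; apply/tm => //; apply/tk.
Qed.

(** A duplicate-free list rather than a set, so that sums over a generation are ordinary big
    operators and the offspring data of its nodes form a sequence. *)
Fixpoint level (t : marked_tree) (h : nat) : seq (seq nat) :=
  if h is h'.+1 then
    [seq rcons u i | u <- level t h', i <- iota 1 (nchildren (nodes t) u)]
  else [:: [::]].

Lemma mem_level t h u : (u \in level t h) <-> (nodes t u /\ size u = h).
Proof.
elim: h u => [|h IH] u /=.
  rewrite inE; split=> [/eqP->|[_ /size0nil ->]//].
  by split=> //; exact: tree_root (nodes_tree t).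
split.
  case/allpairsPdep => v [i] [/IH[tv <-]]; rewrite mem_iota add1n ltnS.
  move=> /andP[i0 ik] ->; rewrite size_rcons; split=> //.
  by apply/(nchildrenP (nodes_tree t)).
case/lastP: u => [[]//|v i [tvi]]; rewrite size_rcons => -[vh].
have tv := tree_parent (nodes_tree t) tvi.
apply/allpairsPdep; exists v, i; split=> //; first exact/IH.
have := tree_words (nodes_tree t) tvi; rewrite /words /= all_rcons => /andP[i0 _].
by rewrite mem_iota i0 add1n ltnS; apply/(nchildrenP (nodes_tree t)).
Qed.

Lemma level_uniq t h : uniq (level t h).
Proof.
elim: h => //= h IH; apply: allpairs_uniq_dep => //.
  by move=> u _; exact: iota_uniq.
by move=> [u i] [v j] _ _ /= /rcons_inj[-> ->].
Qed.

Lemma level_set t h :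
  [set u | nodes t u /\ size u = h] = [set` level t h].
Proof. by apply/seteqP; split=> u /=; rewrite mem_level. Qed.

Lemma ZE h t : Z h t = size (level t h).
Proof.
rewrite /Z level_set; have := fset_setK (finite_seq (level t h)).
move=> eqs; have: perm_eq (fset_set [set` level t h]) (level t h).
  apply: uniq_perm => [||u]; [exact: fset_uniq|exact: level_uniq|].
  by rewrite in_fset_set; [rewrite mem_setE|exact: finite_seq].
by move/perm_size.
Qed.

Lemma fsbig_level (R : Type) (idx : R) (op : Monoid.com_law idx) t h
    (F : seq nat -> R) :
  \big[op/idx]_(u \in [set u | nodes t u /\ (size u < h)%N]) F u =
  \big[op/idx]_(k < h) \big[op/idx]_(u <- level t k) F u.
Proof.
(* Finiteness is carried through the induction because splitting off a level with [fsbigU0] requires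
   it. *)
suff [_ //] : finite_set [set u | nodes t u /\ (size u < h)%N] /\
  \big[op/idx]_(u \in [set u | nodes t u /\ (size u < h)%N]) F u =
  \big[op/idx]_(k < h) \big[op/idx]_(u <- level t k) F u.
elim: h => [|h [finh IH]].
  have -> : [set u | nodes t u /\ (size u < 0)%N] = set0.
    by apply/seteqP; split=> u //= [].
  by split; [exact: finite_set0|rewrite fsbig_set0 big_ord0].
have -> : [set u | nodes t u /\ (size u < h.+1)%N] =
    [set u | nodes t u /\ (size u < h)%N] `|` [set` level t h].
  apply/seteqP; split=> u /=; rewrite mem_level.
    by rewrite ltnS leq_eqVlt => -[tu /orP[/eqP|]]; [right|left].
  by case=> -[tu]; [move=> /leqW|move=> ->].
split; first by rewrite finite_setU; split=> //; exact: finite_seq.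
rewrite fsbigU0//; last by move=> u /= [[_ uh]]; rewrite mem_level => -[_] /eqP; rewrite ltn_eqF.
  by rewrite IH big_ord_recr /= (fsbig_seq _ _ (level_uniq t h)).
exact: finite_seq.
Qed.

Lemma ME h t : M h t = (\sum_(k < h) \sum_(u <- level t k) mark t u)%N.
Proof. by rewrite /M (@fsbig_level _ 0%N addn). Qed.

Lemma restr_le m n t : (m <= n)%N -> restr m (restr n t) = restr m t.
Proof.
move=> mn; apply: marked_treeP => [|u] /=.
  apply/seteqP; split=> u; first by move=> [[tu _] um].
  by move=> [tu um]; split=> //; split=> //; exact: leq_trans um mn.
rewrite /restr_mark /=; case: (ltnP (size u) m) => um; last by rewrite !andbF.
by rewrite /restr_mark (leq_trans um mn) !andbT.
Qed.

Lemma nchildren_restr n t u : (size u < n)%N ->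
  nchildren (nodes (restr n t)) u = nchildren (nodes t) u.
Proof.
move=> un; rewrite /nchildren; congr xget; apply: eq_set => k.
apply/propext; split=> tk i i0; have h := tk i i0.
  by split=> [tu|/h[]//]; apply/h; split; rewrite ?size_rcons.
by split=> [[/h]//|/h ?]; split; rewrite ?size_rcons.
Qed.

Lemma level_restr n t h : (h <= n)%N -> level (restr n t) h = level t h.
Proof.
elim: h => //= h IH hn; rewrite IH 1?ltnW//; congr flatten.
apply/eq_in_map => u /mem_level[_ uh].
by rewrite nchildren_restr// uh.
Qed.

Lemma mark_restr n t u : (size u < n)%N -> mark (restr n t) u = mark t u.
Proof. by move=> un; rewrite /= /restr_mark un andbT. Qed.

Lemma Z_restr n h t : (h <= n)%N -> Z h (restr n t) = Z h t.
Proof. by move=> hn; rewrite !ZE level_restr. Qed.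

Lemma M_restr n h t : (h <= n)%N -> M h (restr n t) = M h t.
Proof.
move=> hn; rewrite !ME; apply: eq_bigr => k _.
rewrite level_restr ?(leq_trans (ltnW (ltn_ord k)))//.
rewrite !big_seq; apply: eq_bigr => u /mem_level[_ uk].
by rewrite mark_restr// uk (leq_trans (ltn_ord k)).
Qed.

Lemma Z0 t : Z 0 t = 1%N. Proof. by rewrite ZE. Qed.

Lemma M0 t : M 0 t = 0%N. Proof. by rewrite ME big_ord0. Qed.

Lemma ZS h t : Z h.+1 t = (\sum_(u <- level t h) nchildren (nodes t) u)%N.
Proof.
rewrite ZE /= size_allpairs_dep sumnE big_map.
by apply: eq_bigr => u _; rewrite size_iota.
Qed.

Lemma MS h t : M h.+1 t = (M h t + \sum_(u <- level t h) mark t u)%N.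
Proof. by rewrite !ME big_ord_recr. Qed.

Definition node_marks (n : nat) (t : marked_tree) : seq (seq nat * bool) :=
  flatten [seq [seq (u, mark (restr n t) u) | u <- level t h] | h <- iota 0 n.+1].

Lemma mem_node_marks n t u b : (u, b) \in node_marks n t <->
  (nodes (restr n t) u /\ b = mark (restr n t) u).
Proof.
split.
  case/flattenP => us /mapP[h]; rewrite mem_iota add0n ltnS => hn ->.
  by case/mapP=> v /mem_level[tv vh] [-> ->]; split=> //; split=> //; rewrite vh.
move=> [[tu un] ->]; apply/flattenP.
exists [seq (u, mark (restr n t) u) | u <- level t (size u)].
  by apply/mapP; exists (size u) => //; rewrite mem_iota.
by apply/mapP; exists u => //; exact/mem_level.
Qed.

(** Numbers the atoms of [Fn n] by integers, which turns an integral over a set of [Fn n] into a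
    series over atoms. *)
Definition code (n : nat) (t : marked_tree) : nat := choice.pickle (node_marks n t).

Lemma codeP n s t : code n s = code n t <-> restr n s = restr n t.
Proof.
split=> [/(pcan_inj choice.pickleK) eqc|eqr]; last first.
  rewrite /code /node_marks eqr; congr (choice.pickle (flatten _)).
  apply/eq_in_map => h; rewrite mem_iota add0n ltnS => hn.
  by rewrite -(level_restr s hn) -(level_restr t hn) eqr.
have sub r r' : node_marks n r = node_marks n r' ->
    forall u, nodes (restr n r) u ->
      nodes (restr n r') u /\ mark (restr n r) u = mark (restr n r') u.
  move=> e u ru; apply/(mem_node_marks n r' u (mark (restr n r) u)).
  by rewrite -e; apply/mem_node_marks.
have mark_sub r r' : node_marks n r = node_marks n r' ->
    forall u, mark (restr n r) u -> mark (restr n r') u.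
  by move=> e u ru; have [_ <-] := sub _ _ e u (mark_nodes ru).
apply: marked_treeP.
  by apply/seteqP; split=> u tu; [have [] := sub _ _ eqc u tu|have [] := sub _ _ (esym eqc) u tu].
by move=> u; apply/idP/idP; exact: mark_sub.
Qed.

(** * One generation of a marked Galton-Watson tree *)

Definition step_data (t : marked_tree) (u : seq nat) : nat * bool :=
  (nchildren (nodes t) u, mark t u).

(** The nodes at height h + 1 are the children of those at height h, and the marks revealed by one
    more level are those at height h: the data of level h are exactly what the new generation
    adds. *)
Lemma restrS_eq h s t : restr h.+1 s = restr h.+1 t <->
  restr h s = restr h t /\
  [seq step_data s u | u <- level t h] = [seq step_data t u | u <- level t h].
Proof.
split=> [est|[est edata]].
  split; first by rewrite -(restr_le s (leqnSn h)) est restr_le.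
  apply/eq_in_map => u /mem_level[_ uh]; have uh1 : (size u < h.+1)%N by rewrite uh.
  rewrite /step_data -(nchildren_restr s uh1) -(nchildren_restr t uh1).
  by rewrite -(mark_restr s uh1) -(mark_restr t uh1) est.
have levst : level s h = level t h.
  by rewrite -(level_restr s (leqnn h)) est level_restr.
move/eq_in_map : edata => edata.
have nodeh u : (size u <= h)%N -> nodes s u <-> nodes t u.
  move=> uh; have : nodes (restr h s) u <-> nodes (restr h t) u by rewrite est.
  by move=> [h1 h2]; split=> [su|tu]; [apply h1|apply h2].
have nodeh1 u : size u = h.+1 -> nodes s u -> nodes t u.
  case/lastP: u => // v i; rewrite size_rcons => -[vh] su.
  have sv := tree_parent (nodes_tree s) su.
  have tv : nodes t v by apply/nodeh => //; rewrite vh.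
  have i0 : (0 < i)%N.
    by have := tree_words (nodes_tree s) su; rewrite /words /= all_rcons => /andP[].
  apply/(nchildrenP (nodes_tree t)) => //.
  have [<- _] := edata v (proj2 (mem_level t h v) (conj tv vh)).
  by apply/(nchildrenP (nodes_tree s)).
have nodeh2 u : size u = h.+1 -> nodes t u -> nodes s u.
  case/lastP: u => // v i; rewrite size_rcons => -[vh] su.
  have sv := tree_parent (nodes_tree t) su.
  have tv : nodes s v by apply/nodeh => //; rewrite vh.
  have i0 : (0 < i)%N.
    by have := tree_words (nodes_tree t) su; rewrite /words /= all_rcons => /andP[].
  apply/(nchildrenP (nodes_tree s)) => //.
  have [-> _] := edata v (proj2 (mem_level t h v) (conj sv vh)).
  by apply/(nchildrenP (nodes_tree t)).
have nodeE u : (size u <= h.+1)%N -> nodes s u <-> nodes t u.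
  rewrite leq_eqVlt => /orP[/eqP uh|]; last exact: nodeh.
  by split; [exact: nodeh1|exact: nodeh2].
apply: marked_treeP => [|u].
  by apply/seteqP; split=> u [su uh]; split=> //; apply/(nodeE u).
rewrite /= /restr_mark; have [uh|_] := boolP (size u < h.+1)%N; last by rewrite !andbF.
rewrite !andbT; move: uh; rewrite ltnS leq_eqVlt => /orP[/eqP uh|uh]; last first.
  by rewrite -(mark_restr s uh) est mark_restr.
have [|nu] := boolP (u \in level t h); first by move/edata => [_ ->].
by apply/idP/idP => /mark_nodes uN; move: nu; rewrite (proj2 (mem_level t h u)) //;
   split=> //; apply/nodeE => //; rewrite uh.
Qed.

Section extension.
Variables (h : nat) (t : marked_tree) (kap : seq nat -> nat) (eps : seq nat -> bool).

Definition ext_nodes : set (seq nat) :=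
  restr_nodes h t `|` [set u | exists v i,
    [/\ u = rcons v i, nodes t v, size v = h & (0 < i <= kap v)%N]].

(** [eps] is defined on all words while marks must vanish off the tree, hence the membership test;
    it also leaves the grafted nodes at height h + 1 unmarked. *)
Definition ext_mark (u : seq nat) : bool :=
  if (size u < h)%N then mark t u else (u \in level t h) && eps u.

Lemma ext_nodesS v i : size v = h -> nodes t v -> (0 < i)%N ->
  ext_nodes (rcons v i) <-> (i <= kap v)%N.
Proof.
move=> vh tv i0; split.
  by case=> [[_]|[v' [i' [/rcons_inj[-> ->] _ _ /andP[]//]]]]; rewrite size_rcons vh ltnn.
by move=> ik; right; exists v, i; split=> //; rewrite i0.
Qed.

Lemma ext_is_tree : is_tree ext_nodes.
Proof.
have [tW t0 tp tc] := nodes_tree t; split.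
- move=> u [[/tW//]|[v [i [-> /tW vW _ /andP[i0 _]]]]].
  by rewrite /words /= all_rcons i0.
- by left; split.
- move=> u j [[/tp tu]|[v [i [/rcons_inj[-> _] tv vh _]]]].
    by rewrite size_rcons => /ltnW uh; left.
  by left; split=> //; rewrite vh.
- move=> u; have [uh|uh|uh] := ltngtP (size u) h.
  + case=> [[/tc[k tk] _]|[v [i [uE _ vh _]]]]; last first.
      by move: uh; rewrite uE size_rcons vh ltnNge leqnSn.
    exists k => i /tk[h1 h2]; split=> [[[/h1//]|]|/h2 tui].
      by move=> [v [i' [/rcons_inj[eu _] _ vh _]]]; move: uh; rewrite eu vh ltnn.
    by left; split=> //; rewrite size_rcons.
  + move=> _; exists 0%N => i i0; split; last by rewrite leqNgt i0.
    case=> [[_]|[v [i' [/rcons_inj[eu _] _ vh _]]]].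
      by rewrite size_rcons ltnNge (ltnW uh).
    by move: uh; rewrite eu vh ltnn.
  + case=> [[tu _]|[v [i [uE _ vh _]]]]; last first.
      by move: uh; rewrite uE size_rcons vh => /eqP; rewrite gtn_eqF.
    by exists (kap u) => i i0; exact: ext_nodesS.
Qed.

Lemma ext_mark_nodes u : ext_mark u -> ext_nodes u.
Proof.
rewrite /ext_mark; case: ifP => [uh /mark_nodes tu|_ /andP[/mem_level[tu uh] _]].
  by left; split=> //; exact: ltnW.
by left; split=> //; rewrite uh.
Qed.

Definition ext := MarkedTree ext_is_tree ext_mark_nodes.

Lemma restr_ext : restr h ext = restr h t.
Proof.
apply: marked_treeP => [|u] /=.
  apply/seteqP; split=> u [].
    move=> [//|[v [i [-> _ vh _]]]]; by rewrite size_rcons vh ltnn.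
  by move=> tu uh; split=> //; left.
by rewrite /restr_mark /= /ext_mark; case: (size u < h)%N; rewrite ?andbF.
Qed.

Lemma step_data_ext u : u \in level t h -> step_data ext u = (kap u, eps u).
Proof.
move=> uL; have /mem_level[tu uh] := uL; rewrite /step_data /= /ext_mark uh ltnn uL.
by congr pair; apply: nchildrenE => i; exact: ext_nodesS.
Qed.

End extension.

(* Any prescription of the numbers of children and marks of the nodes at height h
   is realized by a tree. *)
Lemma exists_extension h t ds : size ds = size (level t h) ->
  exists s, [/\ restr h s = restr h t, level s h = level t h &
    [seq step_data s u | u <- level t h] = ds].
Proof.
move=> sds; pose g u := nth (0%N, false) ds (index u (level t h)).
have rs := restr_ext h t (fun u => (g u).1) (fun u => (g u).2).
exists (ext h t (fun u => (g u).1) (fun u => (g u).2)); split=> //.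
  by rewrite -(level_restr (ext _ _ _ _) (leqnn h)) rs level_restr.
transitivity [seq g u | u <- level t h].
  by apply/eq_in_map => u uL; rewrite step_data_ext//; case: (g u).
apply: (@eq_from_nth _ (0%N, false)); first by rewrite size_map sds.
move=> i; rewrite size_map => il.
by rewrite (nth_map [::])// /g index_uniq//; exact: level_uniq.
Qed.

Lemma measurable_restr n (B : set marked_tree) :
  measurable ([set tau | B (restr n tau)] : set mtree_space).
Proof.
apply: sub_sigma_algebra; exists n => //; exists B => //.
by rewrite setTI.
Qed.

Lemma Fn_measurable n (A : set mtree_space) : Fn n A -> measurable A.
Proof. by move=> FA; apply: sub_sigma_algebra; exists n. Qed.

Lemma FnP n (A : set mtree_space) : Fn n A ->
  exists B : set marked_tree, A = [set tau | B (restr n tau)].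
Proof. by case=> B _ <-; exists B; rewrite setTI. Qed.

Lemma Fn_restr n (B : set marked_tree) : Fn n [set tau | B (restr n tau)].
Proof. by exists B => //; rewrite setTI. Qed.

Lemma Fn_le m n (A : set mtree_space) : (m <= n)%N -> Fn m A -> Fn n A.
Proof.
move=> mn /FnP[B ->]; have := Fn_restr n [set s | B (restr m s)].
by congr Fn; apply: eq_set => tau /=; rewrite restr_le.
Qed.

Lemma measurable_restr_fun n d (U : measurableType d) (g : marked_tree -> U)
    (D : set mtree_space) : measurable D ->
  measurable_fun D (fun tau : mtree_space => g (restr n tau)).
Proof.
move=> mD _ B mB; apply: measurableI => //.
exact: (@measurable_restr n (g @^-1` B)).
Qed.

Section one_step.
Context (R : realType) (P : probability mtree_space R) (p q : nat -> R).
Hypothesis hP : marked_GW p q P.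

Lemma marked_GW_level h (t : marked_tree) :
  P [set tau : mtree_space | restr h tau = restr h t] =
  (\prod_(k < h) \prod_(u <- level t k)
     p0 p q (step_data t u).1 (step_data t u).2)%:E.
Proof.
(* The defining property only concerns positive heights; at height 0 all trees agree, the mark of
   the root being erased. *)
case: h => [|h]; last by rewrite hP// fsbig_level.
rewrite big_ord0 (_ : [set _ | _] = setT) ?probability_setT//.
apply/seteqP; split=> // tau _ /=; apply/codeP.
rewrite /code /node_marks /=; congr choice.pickle; congr [:: (_, _)].
by rewrite /restr_mark !andbF.
Qed.

(** Conditional independence without conditioning: a tree s realizing [ds] turns the event into a
    cylinder of height h + 1, whose product formula has just the factor of level h in addition.
    Nothing is divided by, so null cylinders are allowed. *)
Lemma marked_GW_step h (t : marked_tree) ds : size ds = size (level t h) ->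
  P ([set tau : mtree_space | restr h tau = restr h t] `&`
     [set tau | [seq step_data tau u | u <- level t h] = ds]) =
  (P [set tau : mtree_space | restr h tau = restr h t] *
   \prod_(d <- ds) (p0 p q d.1 d.2)%:E)%E.
Proof.
move=> /exists_extension[s [rs ls sds]].
transitivity (P [set tau | restr h.+1 tau = restr h.+1 s]).
  by congr (P _); apply/seteqP; split=> tau /=; rewrite restrS_eq rs ls sds.
rewrite (marked_GW_level h.+1) big_ord_recr /= EFinM -rs (marked_GW_level h s).
congr (_ * _)%E.
by rewrite ls -sds big_map prodEFin.
Qed.

End one_step.

Section iterated_sum.
Context (R : realType) (w : nat -> bool -> R).
Hypothesis w0 : forall k b, 0 <= w k b.
Local Open Scope ereal_scope.

(** The integral of [F] against the z-fold product of the weights [w], one factor per node, as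
    nested series instead of a product measure. *)
Fixpoint iter_sum (z : nat) (F : seq (nat * bool) -> \bar R) : \bar R :=
  if z is z'.+1 then
    \sum_(0 <= k <oo) \sum_(b : bool)
      (w k b)%:E * iter_sum z' (fun ds => F ((k, b) :: ds))
  else F [::].

Lemma iter_sum_ge0 z F : (forall ds, 0 <= F ds) -> 0 <= iter_sum z F.
Proof.
elim: z F => //= z IH F F0; apply: nneseries_ge0 => k _ _.
by apply: sume_ge0 => b _; rewrite mule_ge0// ?lee_fin//; exact: IH.
Qed.

Lemma eq_iter_sum z F G : (forall ds, F ds = G ds) -> iter_sum z F = iter_sum z G.
Proof. by move=> FG; congr iter_sum; apply/funext. Qed.

(** [B] and [c] are general because the induction restricts to the part of [B] where the first datum
    is (k, b), and the mass of that part carries the extra factor [w k b]. *)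
Lemma integral_iter_sum d (T : measurableType d) (mu : {measure set T -> \bar R})
    (U : Type) (X : T -> U -> nat * bool) (us : seq U) (B : set T) (c : R)
    (F : seq (nat * bool) -> \bar R) :
  measurable B -> (0 <= c)%R -> (forall ds, 0 <= F ds) ->
  (forall u e, measurable [set x | X x u = e]) ->
  measurable_fun B (fun x => F [seq X x u | u <- us]) ->
  (forall ds, size ds = size us ->
    mu (B `&` [set x | [seq X x u | u <- us] = ds]) =
    c%:E * \prod_(e <- ds) (w e.1 e.2)%:E) ->
  \int[mu]_(x in B) F [seq X x u | u <- us] = c%:E * iter_sum (size us) F.
Proof.
move=> + + + mX; elim: us B c F => /= [|u us IH] B c F mB c0 F0 mF hB.
  rewrite integral_cst// muleC -[c%:E]mule1 -(big_nil 1 mule predT (fun e => (w e.1 e.2)%:E)).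
  by rewrite -hB//; congr (mu _ * _); rewrite setIidl.
have ge0F x : 0 <= F (X x u :: [seq X x v | v <- us]) by [].
pose Bk k := \big[setU/set0]_(b : bool) (B `&` [set x | X x u = (k, b)]).
have mBk k : measurable (Bk k) by apply: bigsetU_measurable => b _; exact: measurableI.
have BkE k : Bk k = (B `&` [set x | (X x u).1 = k]).
  rewrite /Bk big_bool; apply/seteqP; split=> x /=.
    by case=> -[Bx ->].
  by case=> Bx; case: (X x u) => k' [] /= <-; [left|right].
have BE : B = \bigcup_k Bk k.
  apply/seteqP; split=> x.
    by move=> Bx; exists (X x u).1 => //; rewrite BkE.
  by case=> k _; rewrite BkE => -[].
have := @ge0_integral_bigcup _ _ _ mu Bk (fun x => F (X x u :: [seq X x v | v <- us])) mBk.
rewrite /= -BE => ->//; last first.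
  by move=> i j _ _ [x []]; rewrite !BkE => -[_ <-] [_ <-].
rewrite -nneseriesZl//; last first.
  move=> k _; apply: sume_ge0 => b _; rewrite mule_ge0// ?lee_fin//.
  exact: iter_sum_ge0.
apply: eq_eseriesr => k _.
rewrite ge0_integral_bigsetU//=; last 4 first.
- by move=> b; exact: measurableI.
- exact: index_enum_uniq.
- move=> i j _ _ [x [[_ /= xi] [_ xj]]].
  by move: xj; rewrite /= xi => -[].
- by apply: measurable_funS mF => //; rewrite -/(Bk k) BkE; exact: subIsetl.
rewrite ge0_sume_distrr; last first.
  by move=> b _; rewrite mule_ge0// ?lee_fin//; exact: iter_sum_ge0.
apply: eq_bigr => b _; rewrite muleA -EFinM.
rewrite -(IH (B `&` [set x | X x u = (k, b)]) _ (fun ds => F ((k, b) :: ds)))//.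
- by apply: eq_integral => x; rewrite inE => -[_ /= ->].
- exact: measurableI.
- by rewrite mulr_ge0.
- apply: (eq_measurable_fun (fun x => F (X x u :: [seq X x v | v <- us]))).
    by move=> x; rewrite inE => -[_ /= ->].
  by apply: measurable_funS mF => //; exact: subIsetl.
- move=> ds sds; have := hB ((k, b) :: ds).
  rewrite /= sds big_cons muleA -EFinM => <- //; congr (mu _).
  rewrite -setIA; congr (_ `&` _); apply/seteqP; split=> x /=.
    by move=> [-> ->].
  by move=> [-> ->].
Qed.

End iterated_sum.

Section partition.
Context (R : realType) (P : probability mtree_space R).
Local Open Scope ereal_scope.

(* It suffices to compare integrals on the atoms of [Fn n]. *)
Lemma Fn_eq_integral n (f g : mtree_space -> \bar R) :
  measurable_fun setT f -> measurable_fun setT g ->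
  (forall x, 0 <= f x) -> (forall x, 0 <= g x) ->
  (forall t : marked_tree,
    \int[P]_(x in [set tau : mtree_space | restr n tau = restr n t]) f x =
    \int[P]_(x in [set tau : mtree_space | restr n tau = restr n t]) g x) ->
  forall A : set mtree_space, Fn n A -> \int[P]_(x in A) f x = \int[P]_(x in A) g x.
Proof.
move=> mf mg f0 g0 fg A /FnP[B AB].
pose Ak k : set mtree_space := A `&` [set tau | code n tau = k].
have Ak0 k : Ak k = set0 \/
    exists t : marked_tree, Ak k = [set tau : mtree_space | restr n tau = restr n t].
  have [->|/set0P[t [At tk]]] := eqVneq (Ak k) set0; [by left|right; exists t].
  rewrite /Ak -tk; apply/seteqP; split=> tau /=.
    by move=> [_ /codeP].
  by move=> e; split; [move: At; rewrite AB /= e|exact/codeP].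
have mA k : measurable (Ak k).
  have [->//|[t ->]] := Ak0 k.
  exact: (@measurable_restr n (fun s => s = restr n t)).
have AE : A = \bigcup_k Ak k.
  apply/seteqP; split=> x; last by case=> k _ [].
  by move=> Ax; exists (code n x).
have tA : trivIset setT Ak by move=> i j _ _ [x [[_ /= <-] [_ /= <-]]].
rewrite AE !ge0_integral_bigcup//; last 2 first.
- exact: measurable_funTS.
- exact: measurable_funTS.
apply: eq_eseriesr => k _.
by have [->|[t ->]] := Ak0 k; rewrite ?integral_set0// fg.
Qed.

End partition.

(** * Generating functions *)

Lemma bin_le_exp n a : ('C(n, a) <= n ^ a)%N.
Proof.
elim: a => [|a IH]; first by rewrite bin0.
apply: (@leq_trans (a.+1 * 'C(n, a.+1))); first by rewrite leq_pmull.
by rewrite mul_bin_left expnS leq_mul// leq_subr.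
Qed.

Section generating_polynomials.
Context (R : realType).

(* Exponential generating functions are represented by polynomials, only the
   coefficients of degree at most [l] of which are meaningful. *)
Definition exp_poly (l : nat) : {poly R} := \poly_(i < l.+1) (i`!%:R)^-1.

(** Finite for a <= l by the moment of order l, so that [fine] loses nothing for the orders entering
    [step_op]. *)
Definition binomial_moment (p q : nat -> R) (b : bool) (a : nat) : R :=
  fine (\sum_(0 <= k <oo) (p0 p q k b * 'C(k, a)%:R)%:E).

(** The operator T rewritten in powers of E - 1: expanding E^k by the binomial theorem and summing
    over k produces the binomial moments, weighted by 1 for an unmarked node and by e^s for a marked
    one. *)
Definition step_op (p q : nat -> R) (l : nat) (E : {poly R}) : {poly R} :=
  \sum_(a < l.+1) ((binomial_moment p q false a)%:P +
                   binomial_moment p q true a *: exp_poly l) * (E - 1) ^+ a.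

Lemma coef_exp_poly l i : (i <= l)%N -> (exp_poly l)`_i = (i`!%:R)^-1.
Proof. by move=> il; rewrite coef_poly ltnS il. Qed.

Definition nneg_coef (E : {poly R}) : Prop := forall i, 0 <= E`_i.

Lemma nneg_coefM E F : nneg_coef E -> nneg_coef F -> nneg_coef (E * F).
Proof. by move=> E0 F0 i; rewrite coefM sumr_ge0// => j _; rewrite mulr_ge0. Qed.

Lemma nneg_coefX E n : nneg_coef E -> nneg_coef (E ^+ n).
Proof.
move=> E0; elim: n => [|n IH]; last by rewrite exprS; exact: nneg_coefM.
by move=> i; rewrite expr0 coef1.
Qed.

Lemma exp_poly_nneg l : nneg_coef (exp_poly l).
Proof.
by move=> i; rewrite coef_poly; case: ifP.
Qed.

Lemma coef_exp_poly_exp l m i : (i <= l)%N ->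
  (exp_poly l ^+ m)`_i = m%:R ^+ i / i`!%:R.
Proof.
elim: m i => [|m IH] i il.
  by rewrite expr0 coef1 expr0n; case: i il => [|i] _ //=; rewrite ?mul0r ?mulr0n// divr1.
rewrite exprS coefM -natr1 [in RHS]exprDn mulr_suml; apply: eq_bigr => k _.
have ki : (k <= i)%N by rewrite -ltnS.
rewrite coef_exp_poly ?(leq_trans ki)// IH ?(leq_trans (leq_subr _ _))//.
rewrite expr1n mulr1 -mulr_natr -(bin_fact ki) !natrM.
have f0 n : n`!%:R != 0 :> R by rewrite pnatr_eq0 -lt0n fact_gt0.
have c0 : 'C(i, k)%:R != 0 :> R by rewrite pnatr_eq0 -lt0n bin_gt0.
by field; rewrite !f0 c0.
Qed.

Lemma coef_exp_lt (N : {poly R}) a i : N`_0 = 0 -> (i < a)%N -> (N ^+ a)`_i = 0.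
Proof.
move=> N0; elim: a i => // a IH i ia; rewrite exprS coefM big1// => j _.
case: j => [[|j] /= ji]; first by rewrite N0 mul0r.
rewrite IH ?mulr0//; move: ji ia; rewrite !ltnS => ji ia.
by rewrite (leq_trans _ ia)// ltn_subrL (leq_trans _ ji).
Qed.

Lemma coefM_exp_lt (Q N : {poly R}) a i : N`_0 = 0 -> (i < a)%N ->
  (Q * N ^+ a)`_i = 0.
Proof.
move=> N0 ia; rewrite coefM big1// => j _; rewrite coef_exp_lt ?mulr0//.
exact: leq_ltn_trans (leq_subr _ _) ia.
Qed.

(** The range of a can be l instead of k: both sums extend to max(k, l), since binomial(k, a) = 0
    for a > k, and (E - 1)^a has no coefficient of degree i <= l for a > l. *)
Lemma coefM_exp_binomial (Q E : {poly R}) k l i : E`_0 = 1 -> (i <= l)%N ->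
  (Q * E ^+ k)`_i = \sum_(a < l.+1) 'C(k, a)%:R * (Q * (E - 1) ^+ a)`_i.
Proof.
move=> E0 il; have N0 : (E - 1)`_0 = 0 by rewrite coefB coef1 E0 subrr.
have gen n : (k <= n)%N ->
    (Q * E ^+ k)`_i = \sum_(a < n.+1) 'C(k, a)%:R * (Q * (E - 1) ^+ a)`_i.
  move=> kn; rewrite -{1}[E](subrK 1) addrC exprDn mulr_sumr coef_sum.
  rewrite (big_ord_widen n.+1 (fun a => (Q * (1 ^+ (k - a) * (E - 1) ^+ a *+ 'C(k, a)))`_i)) //.
  rewrite big_mkcond /=; apply: eq_bigr => a _; rewrite expr1n mul1r mulrnAr coefMn mulr_natl.
  by rewrite ltnS; case: leqP => // ka; rewrite bin_small// mulr0n.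
rewrite (gen (maxn k l)) ?leq_maxl//.
rewrite [RHS](big_ord_widen (maxn k l).+1
  (fun a => 'C(k, a)%:R * (Q * (E - 1) ^+ a)`_i)); last first.
  by rewrite ltnS leq_maxr.
rewrite [RHS]big_mkcond; apply: eq_bigr => a _; case: ifPn => //.
rewrite -leqNgt => la; rewrite coefM_exp_lt ?mulr0//.
exact: leq_ltn_trans il la.
Qed.

Section offspring.
Context (p q : nat -> R) (l : nat).
Hypothesis (hp : offspring_distribution p) (hl : (moment p l < +oo)%E)
  (hq : mark_function q).

Lemma p0_ge0 k b : 0 <= p0 p q k b.
Proof.
have p0 := offspring_ge0 hp k; have /andP[q0 q1] := hq k.
by case: b; rewrite /p0 mulr_ge0// subr_ge0.
Qed.

Lemma p0_le k b : p0 p q k b <= p k.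
Proof.
have p0 := offspring_ge0 hp k; have /andP[q0 q1] := hq k.
by case: b; rewrite /p0 ler_piMr// lerBlDr lerDl.
Qed.

Lemma binomial_momentE b a : (a <= l)%N ->
  (\sum_(0 <= k <oo) (p0 p q k b * 'C(k, a)%:R)%:E)%E = (binomial_moment p q b a)%:E.
Proof.
move=> al; rewrite fineK// ge0_fin_numE; last first.
  by apply: nneseries_ge0 => k _ _; rewrite lee_fin mulr_ge0// p0_ge0.
(* The domination is binomial(k, a) <= 1 + k^l, where the 1 serves for k = a = 0. *)
apply: (@le_lt_trans _ _ (\sum_(0 <= k <oo) ((p k)%:E + (k%:R ^+ l * p k)%:E))%E).
  apply: lee_nneseries => k _; first by move=> _; rewrite lee_fin mulr_ge0// p0_ge0.
  rewrite -EFinD lee_fin -[X in X + _]mul1r -mulrDl mulrC.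
  apply: ler_pM => //; [exact: p0_ge0| |exact: p0_le].
  rewrite -natrX -(natrD _ 1) ler_nat.
  have [ak|ka] := leqP a k; last by rewrite bin_small.
  case: k ak => [|k] ak; first by move: ak; rewrite leqn0 => /eqP ->; rewrite bin0.
  apply: (leq_trans (bin_le_exp _ _)).
  by rewrite (leq_trans (leq_pexp2l _ al))// leq_addl.
rewrite nneseriesD//; last 2 first.
- by move=> k _ _; rewrite lee_fin (offspring_ge0 hp).
- by move=> k _ _; rewrite lee_fin mulr_ge0// (offspring_ge0 hp).
by rewrite (offspring_sum1 hp) lte_add_pinfty// ltry.
Qed.

Lemma binomial_moment_ge0 b a : 0 <= binomial_moment p q b a.
Proof.
by apply/fine_ge0/nneseries_ge0 => k _ _; rewrite lee_fin mulr_ge0// p0_ge0.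
Qed.

Lemma nneg_coef_sub1 (E : {poly R}) : nneg_coef E -> E`_0 = 1 ->
  nneg_coef (E - 1).
Proof.
by move=> En E0 [|i]; rewrite coefB coef1 /= ?E0 ?subrr ?subr0.
Qed.

Lemma step_op_nneg E : nneg_coef E -> E`_0 = 1 ->
  nneg_coef (step_op p q l E).
Proof.
move=> En E0 i; rewrite coef_sum sumr_ge0// => a _.
apply: nneg_coefM; last exact/nneg_coefX/nneg_coef_sub1.
move=> j; rewrite coefD coefC coefZ addr_ge0//.
  by case: ifP => // _; exact: binomial_moment_ge0.
by rewrite mulr_ge0 ?binomial_moment_ge0//; exact: exp_poly_nneg.
Qed.

(** Dropping the powers of E - 1 beyond l changes nothing up to degree l, and nonnegativity lets the
    series over k be exchanged with the finite sums over a and b. *)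
Lemma step_op_series E i : nneg_coef E -> E`_0 = 1 -> (i <= l)%N ->
  (\sum_(0 <= k <oo) \sum_(b : bool) (p0 p q k b * (exp_poly l ^+ b * E ^+ k)`_i)%:E)%E
  = ((step_op p q l E)`_i)%:E.
Proof.
move=> En E0 il; have Nn := nneg_coef_sub1 En E0.
have c0 a b : 0 <= (exp_poly l ^+ nat_of_bool b * (E - 1) ^+ a)`_i.
  by apply: nneg_coefM; apply: nneg_coefX => //; exact: exp_poly_nneg.
transitivity (\sum_(b : bool) \sum_(a < l.+1)
   (binomial_moment p q b a * (exp_poly l ^+ b * (E - 1) ^+ a)`_i)%:E)%E; last first.
  rewrite big_bool /= -big_split/= sumEFin /step_op coef_sum; congr EFin.
  apply: eq_bigr => a _.
  by rewrite expr1 expr0 mul1r mulrDl coefD coefCM -scalerAl coefZ addrC.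
rewrite nneseries_sum; last first.
  move=> b k _; rewrite lee_fin mulr_ge0 ?p0_ge0//.
  rewrite (coefM_exp_binomial _ _ E0 il) sumr_ge0// => a _; exact: mulr_ge0.
apply: eq_bigr => b _.
under eq_eseriesr => k _ do
  rewrite (coefM_exp_binomial _ _ E0 il) mulr_sumr -sumEFin.
rewrite nneseries_sum; last by move=> a k _; rewrite lee_fin mulr_ge0 ?p0_ge0// mulr_ge0.
apply: eq_bigr => a _.
under eq_eseriesr => k _ do rewrite mulrA mulrC EFinM.
rewrite nneseriesZl; last by move=> k _; rewrite lee_fin mulr_ge0// p0_ge0.
have al : (a <= l)%N by rewrite -ltnS.
by rewrite (binomial_momentE b al) -EFinM mulrC.
Qed.

Lemma step_op0 E : nneg_coef E -> E`_0 = 1 -> (step_op p q l E)`_0 = 1.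
Proof.
move=> En E0; apply/EFin_inj; rewrite -step_op_series// -(offspring_sum1 hp).
apply: eq_eseriesr => k _; rewrite big_bool /= !expr0 expr1 mul1r coefM big_ord1.
have -> : (E ^+ k)`_0 = 1.
  by elim: k => [|k IH]; rewrite ?expr0 ?coef1// exprS coefM big_ord1 E0 IH mulr1.
by rewrite coef_exp_poly// fact0 invr1 !mulr1 -EFinD /p0 -mulrDr subrKC mulr1.
Qed.

(** The branching property: independent nodes contribute a z-th power. [Q] gathers the contributions
    of the nodes already treated, so it must vary in the induction on z. *)
Lemma iter_sum_coef z E Q j : nneg_coef E -> E`_0 = 1 ->
  nneg_coef Q -> (j <= l)%N ->
  iter_sum (p0 p q) z (fun ds => ((Q *
     (exp_poly l ^+ (\sum_(d <- ds) d.2) * E ^+ (\sum_(d <- ds) d.1)))`_j)%:E) =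
  ((Q * step_op p q l E ^+ z)`_j)%:E.
Proof.
move=> En E0 Qn jl; have En' := step_op_nneg En E0; elim: z Q Qn => [|z IH] Q Qn /=.
  by rewrite !big_nil !expr0 mulr1.
have Qz : nneg_coef (Q * step_op p q l E ^+ z) by apply: nneg_coefM => //; exact: nneg_coefX.
have eEn (b : bool) k : nneg_coef (exp_poly l ^+ b * E ^+ k).
  by apply: nneg_coefM; apply: nneg_coefX => //; exact: exp_poly_nneg.
transitivity (\sum_(0 <= k <oo) \sum_(b : bool) \sum_(i < j.+1)
   ((Q * step_op p q l E ^+ z)`_(j - i))%:E *
   (p0 p q k b * (exp_poly l ^+ b * E ^+ k)`_i)%:E)%E.
  apply: eq_eseriesr => k _; apply: eq_bigr => b _.
  rewrite (@eq_iter_sum _ _ z _ (fun ds => ((Q * (exp_poly l ^+ b * E ^+ k) *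
     (exp_poly l ^+ (\sum_(d <- ds) d.2) * E ^+ (\sum_(d <- ds) d.1)))`_j)%:E)); last first.
    move=> ds; rewrite !big_cons /= !exprD; congr (coefp j _)%:E.
    by rewrite -!mulrA; congr (_ * (_ * _)); rewrite mulrCA.
  rewrite IH; last exact: nneg_coefM.
  rewrite -EFinM mulrAC coefMr mulr_sumr -sumEFin.
  by apply: eq_bigr => i _; rewrite -EFinM mulrCA.
under eq_eseriesr => k _ do rewrite exchange_big/=.
rewrite nneseries_sum; last first.
  move=> i k _; apply: sume_ge0 => b _.
  by rewrite mule_ge0 ?lee_fin ?Qz// mulr_ge0 ?p0_ge0//; exact: eEn.
rewrite exprSr mulrA coefMr -sumEFin; apply: eq_bigr => i _.
transitivity (\sum_(0 <= k <oo) ((Q * step_op p q l E ^+ z)`_(j - i))%:E *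
   \sum_(b : bool) (p0 p q k b * (exp_poly l ^+ b * E ^+ k)`_i)%:E)%E.
  apply: eq_eseriesr => k _; rewrite ge0_sume_distrr// => b _.
  by rewrite lee_fin mulr_ge0 ?p0_ge0//; exact: eEn.
have il : (i <= l)%N by apply: leq_trans jl; rewrite -ltnS.
rewrite nneseriesZl ?step_op_series// => k _; apply: sume_ge0 => b _.
by rewrite lee_fin mulr_ge0 ?p0_ge0//; exact: eEn.
Qed.

End offspring.
End generating_polynomials.

(** * Moments of the number of marks, given the first n generations *)

Section conditional_moments.
Context (R : realType) (P : probability mtree_space R) (p q : nat -> R) (l : nat).
Hypothesis (hP : marked_GW p q P).
Hypothesis (hp : offspring_distribution p) (hl : (moment p l < +oo)%E)
  (hq : mark_function q).

Let coefMZ j n (E : {poly R}) (t : marked_tree) : R :=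
  (exp_poly R l ^+ M n t * E ^+ Z n t)`_j.

Lemma measurable_MZ d (U : measurableType d) (g : nat -> nat -> U) n
    (D : set mtree_space) : measurable D ->
  measurable_fun D (fun tau : mtree_space => g (M n tau) (Z n tau)).
Proof.
move=> mD; rewrite (_ : (fun _ => _) =
  (fun tau : mtree_space => (fun s => g (M n s) (Z n s)) (restr n tau))).
  exact: (@measurable_restr_fun n _ _ (fun s => g (M n s) (Z n s))).
by apply/funext => tau /=; rewrite M_restr// Z_restr.
Qed.

Lemma nneg_coefMZ j n E t : nneg_coef E -> 0 <= coefMZ j n E t.
Proof.
by move=> E0; apply: nneg_coefM; apply: nneg_coefX => //; exact: exp_poly_nneg.
Qed.

Lemma integral_step n j (E : {poly R}) (A : set mtree_space) : Fn n A ->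
  nneg_coef E -> E`_0 = 1 -> (j <= l)%N ->
  (\int[P]_(x in A) (coefMZ j n.+1 E x)%:E =
   \int[P]_(x in A) (coefMZ j n (step_op p q l E) x)%:E)%E.
Proof.
move=> + En E0 jl; move: A; apply: Fn_eq_integral.
- exact: (measurable_MZ (fun m z => ((exp_poly R l ^+ m * E ^+ z)`_j)%:E)).
- exact: (measurable_MZ (fun m z => ((exp_poly R l ^+ m * step_op p q l E ^+ z)`_j)%:E)).
- by move=> x; rewrite lee_fin nneg_coefMZ.
- by move=> x; rewrite lee_fin nneg_coefMZ//; exact: step_op_nneg.
move=> t; set B := [set _ | _].
have mB : measurable B by exact: (@measurable_restr n (fun s => s = restr n t)).
have levelB x : B x -> level x n = level t n.
  by move=> /= xt; rewrite -(level_restr x (leqnn n)) xt level_restr.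
have MB x : B x -> M n x = M n t by move=> /= xt; rewrite -(M_restr x (leqnn n)) xt M_restr.
have ZB x : B x -> Z n x = Z n t by move=> /= xt; rewrite -(Z_restr x (leqnn n)) xt Z_restr.
have PB : P B = (fine (P B))%:E by rewrite fineK// fin_num_measure.
pose F (ds : seq (nat * bool)) := ((exp_poly R l ^+ M n t *
  (exp_poly R l ^+ (\sum_(d <- ds) d.2) * E ^+ (\sum_(d <- ds) d.1)))`_j)%:E.
have FE (x : mtree_space) : B x ->
    (coefMZ j n.+1 E x)%:E = F [seq step_data x u | u <- level t n].
  move=> Bx; rewrite /coefMZ /F MS ZS !big_map levelB// MB//.
  by rewrite exprD mulrA.
transitivity (\int[P]_(x in B) F [seq step_data x u | u <- level t n])%E.
  by apply: eq_integral => x /[!inE] Bx; exact: FE.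
rewrite (@integral_iter_sum _ (p0 p q) _ _ _ P _ step_data _ _ (fine (P B)))//.
- rewrite iter_sum_coef//; last exact/nneg_coefX/exp_poly_nneg.
  rewrite -ZE -PB muleC -integral_cst//; apply: eq_integral => x /[!inE] Bx.
  by rewrite /coefMZ MB// ZB.
- by move=> k b; exact: p0_ge0.
- by rewrite fine_ge0.
- move=> ds; rewrite lee_fin; apply: nneg_coefM; first exact/nneg_coefX/exp_poly_nneg.
  by apply: nneg_coefM; apply: nneg_coefX => //; exact: exp_poly_nneg.
(* The number of children and the mark of u are visible in the truncation at height |u| + 1. *)
- move=> u e; rewrite (_ : [set _ | _] = [set tau : mtree_space |
      [set s | step_data s u = e] (restr (size u).+1 tau)]).
    exact: measurable_restr.
  by apply/seteqP; split=> x /=; rewrite /step_data nchildren_restr ?mark_restr.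
- apply: (eq_measurable_fun (fun x : mtree_space => (coefMZ j n.+1 E x)%:E)).
    by move=> x /[!inE]; exact: FE.
  exact: (measurable_MZ (fun m z => ((exp_poly R l ^+ m * E ^+ z)`_j)%:E)).
- by move=> ds sds; rewrite -PB; exact: marked_GW_step.
Qed.

Lemma integral_iter_step n k j (E : {poly R}) (A : set mtree_space) : Fn n A ->
  nneg_coef E -> E`_0 = 1 -> (j <= l)%N ->
  (\int[P]_(x in A) (coefMZ j (n + k) E x)%:E =
   \int[P]_(x in A) (coefMZ j n (iter k (step_op p q l) E) x)%:E)%E.
Proof.
move=> FA + + jl; elim: k E => [|k IH] E En E0; first by rewrite addn0.
rewrite addnS (integral_step (Fn_le (leq_addr k n) FA) En E0 jl).
by rewrite IH ?iterSr//; [exact: step_op_nneg|exact: step_op0].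
Qed.

Definition moment_poly (k : nat) : {poly R} := iter k (step_op p q l) 1.

Lemma moment_poly_nneg k : nneg_coef (moment_poly k) /\ (moment_poly k)`_0 = 1.
Proof.
elim: k => [|k [IHn IH0]].
  by split=> [i|]; rewrite /= coef1.
by split; [exact: step_op_nneg|exact: step_op0].
Qed.

Lemma expectation_indicM (A : set mtree_space) (X : mtree_space -> R) :
  ('E_P[fun tau => (\1_A tau * X tau)%R] = \int[P]_(x in A) (X x)%:E)%E.
Proof.
rewrite unlock [RHS]integral_mkcond; apply: eq_integral => x _.
by rewrite indicE patchE; case: ifP => _; rewrite ?mul1r ?mul0r.
Qed.

(** Start the iteration from E = 1 at time n + k: then E^Z = 1, and the coefficient of degree j of
    e^(sM) is M^j / j!. *)
Lemma expectation_moment_poly n k j (A : set mtree_space) : Fn n A -> (j <= l)%N ->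
  ('E_P[fun tau => (\1_A tau * (M (n + k) tau)%:R ^+ j)%R] =
   (j`!%:R)%:E * \int[P]_(x in A) (coefMZ j n (moment_poly k) x)%:E)%E.
Proof.
move=> FA jl; have [E0 E1] := moment_poly_nneg 0.
rewrite expectation_indicM -integral_iter_step// -ge0_integralZl_EFin//; last 3 first.
- exact: Fn_measurable FA.
- by move=> x _; rewrite lee_fin nneg_coefMZ.
- exact: (measurable_MZ (fun m z => ((exp_poly R l ^+ m * 1 ^+ z)`_j)%:E) _ (Fn_measurable FA)).
apply: eq_integral => x _; rewrite /coefMZ expr1n mulr1 coef_exp_poly_exp// -EFinM.
by rewrite mulrC divfK// pnatr_eq0 -lt0n fact_gt0.
Qed.

Lemma Mmoment_poly k j : (j <= l)%N -> Mmoment P j k = (j`!%:R * (moment_poly k)`_j)%:E.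
Proof.
move=> jl; have FT : Fn 0 [set: mtree_space] by exists setT => //; rewrite setTI preimage_setT.
have := @expectation_moment_poly 0 k j [set: mtree_space] FT jl.
rewrite add0n (_ : (fun tau => _) = (fun tau => (M k tau)%:R ^+ j : R)); last first.
  by apply/funext => tau; rewrite indicT mul1r.
rewrite /Mmoment => ->; rewrite EFinM; congr (_ * _)%E.
rewrite (_ : (fun x => _) = cst ((moment_poly k)`_j)%:E); last first.
  by apply/funext => x; rewrite /coefMZ M0 Z0 expr0 expr1 mul1r.
by rewrite integral_cst// -[RHS]mule1; congr (_ * _)%E; exact: probability_setT.
Qed.

Definition mixed_moment n (A : set mtree_space) (i a : nat) : R :=
  fine (\int[P]_(x in A) ((M n x)%:R ^+ (l - i) * 'C(Z n x, a)%:R)%:E).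

(** Start from E = e^s at time n: the coefficient of degree l of e^(s(M+Z)) is (M+Z)^l / l!, and
    going back to time 0 evaluates its mean as a polynomial coefficient, hence a real number. All
    mixed moments are dominated through this one. *)
Lemma integral_MZ_lty n : (\int[P]_x (((M n x + Z n x)%N%:R : R) ^+ l)%:E < +oo)%E.
Proof.
have FT : Fn 0 [set: mtree_space] by exists setT => //; rewrite setTI preimage_setT.
have E0 : (exp_poly R l)`_0 = 1 by rewrite coef_exp_poly// fact0 invr1.
have := @integral_iter_step 0 n l (exp_poly R l) [set: mtree_space] FT
  (exp_poly_nneg R l) E0 (leqnn l).
rewrite [X in _ = X -> _](_ : _ = ((iter n (step_op p q l) (exp_poly R l))`_l)%:E); last first.
  rewrite (_ : (fun x => _) = cst ((iter n (step_op p q l) (exp_poly R l))`_l)%:E).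
    by rewrite integral_cst// -[RHS]mule1; congr (_ * _)%E; exact: probability_setT.
  by apply/funext => x; rewrite /coefMZ M0 Z0 expr0 expr1 mul1r.
rewrite add0n (_ : (fun x => _) = 
  (fun x => (l`!%:R^-1)%:E * (((M n x + Z n x)%N%:R : R) ^+ l)%:E)%E); last first.
  by apply/funext => x; rewrite /coefMZ -exprD coef_exp_poly_exp// -EFinM mulrC.
rewrite ge0_integralZl_EFin//; last first.
  exact: (measurable_MZ (fun m z => (((m + z)%N%:R : R) ^+ l)%:E)).
have f0 : (l`!%:R : R) != 0 by rewrite pnatr_eq0 -lt0n fact_gt0.
move=> /(congr1 (fun x => (l`!%:R)%:E * x)%E); rewrite muleA -EFinM divff// mul1e => ->.
by rewrite -EFinM ltry.
Qed.

Lemma mixed_momentE n (A : set mtree_space) (i a : nat) : measurable A ->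
  (a <= i <= l)%N ->
  (\int[P]_(x in A) ((M n x)%:R ^+ (l - i) * 'C(Z n x, a)%:R)%:E =
   (mixed_moment n A i a)%:E)%E.
Proof.
move=> mA /andP[ai il]; rewrite fineK// ge0_fin_numE; last first.
  by apply: integral_ge0 => x _; rewrite lee_fin mulr_ge0// exprn_ge0.
apply: (@le_lt_trans _ _ (\int[P]_x (1 + ((M n x + Z n x)%N%:R ^+ l)%:E)))%E; last first.
  rewrite ge0_integralD//; last first.
    exact: (measurable_MZ (fun m z => (((m + z)%N%:R : R) ^+ l)%:E)).
  rewrite lte_add_pinfty ?integral_MZ_lty// integral_cst// mul1e.
  by rewrite [ltLHS](_ : _ = 1%E) ?ltry//; exact: probability_setT.
apply: (@le_trans _ _ (\int[P]_(x in A) (1 + ((M n x + Z n x)%N%:R ^+ l)%:E)))%E.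
  apply: ge0_le_integral => //.
  - exact: (measurable_MZ (fun m z => ((m%:R : R) ^+ (l - i) * 'C(z, a)%:R)%:E)).
  - exact: (measurable_MZ (fun m z => (1 + ((m + z)%N%:R ^+ l : R)%:E)%E)).
  move=> x _; rewrite -EFinD lee_fin -!natrX -natrM -(natrD _ 1) ler_nat.
  apply: (@leq_trans (M n x ^ (l - i) * Z n x ^ a)); first by rewrite leq_mul// bin_le_exp.
  (* When M = Z = 0 the left side can be 0^0 = 1 while (M+Z)^l = 0; this is why 1 was added to the
     bound. *)
  have [/eqP|mz] := posnP (M n x + Z n x).
    rewrite addn_eq0 => /andP[/eqP-> /eqP->]; apply: (@leq_trans 1); last exact: leq_addr.
    have e01 k : (0 ^ k <= 1)%N by case: k => [|k] //; rewrite exp0n.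
    by rewrite -[1%N]muln1 leq_mul.
  apply: (@leq_trans ((M n x + Z n x) ^ (l - i + a))).
    have le_exp k m m' : (m <= m')%N -> (m ^ k <= m' ^ k)%N.
      by case: k => // k; rewrite leq_exp2r.
    by rewrite expnD leq_mul// le_exp ?leq_addr ?leq_addl.
  apply: (@leq_trans ((M n x + Z n x) ^ l)); last exact: leq_addl.
  by rewrite leq_pexp2l//; lia.
apply: ge0_subset_integral => //.
  exact: (measurable_MZ (fun m z => (1 + ((m + z)%N%:R ^+ l : R)%:E)%E)).
by move=> x _; rewrite adde_ge0// lee_fin exprn_ge0.
Qed.

Lemma expectation_mixed n (A : set mtree_space) (c : nat -> nat -> R) :
  measurable A -> (forall i a, 0 <= c i a) ->
  'E_P[fun tau => (\1_A tau * \sum_(i < l.+1) \sum_(a < i.+1)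
      c i a * ((M n tau)%:R ^+ (l - i) * 'C(Z n tau, a)%:R))%R]%E =
  (\sum_(i < l.+1) \sum_(a < i.+1) c i a * mixed_moment n A i a)%:E.
Proof.
move=> mA c0; rewrite expectation_indicM.
have t0 i a x : 0 <= (M n x)%:R ^+ (l - i) * 'C(Z n x, a)%:R :> R.
  by rewrite mulr_ge0// exprn_ge0.
under eq_integral => x _.
  rewrite -sumEFin; under eq_bigr => i _ do rewrite -sumEFin.
  over.
rewrite ge0_integral_sum//; last 2 first.
- move=> i; apply: emeasurable_sum => a.
  exact: (measurable_MZ (fun m z => (c i a * ((m%:R : R) ^+ (l - i) * 'C(z, a)%:R))%:E)).
- by move=> i x _; apply: sume_ge0 => a _; rewrite lee_fin mulr_ge0.
rewrite -sumEFin; apply: eq_bigr => i _; rewrite ge0_integral_sum//; last 2 first.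
- move=> a; exact: (measurable_MZ (fun m z => (c i a * ((m%:R : R) ^+ (l - i) * 'C(z, a)%:R))%:E)).
- by move=> a x _; rewrite lee_fin mulr_ge0.
rewrite -sumEFin; apply: eq_bigr => a _.
under eq_integral => x _ do rewrite EFinM.
rewrite ge0_integralZl_EFin//; last first.
  exact: (measurable_MZ (fun m z => ((m%:R : R) ^+ (l - i) * 'C(z, a)%:R)%:E)).
by rewrite mixed_momentE// -ltnS ltn_ord -ltnS /=.
Qed.

Lemma expectation_indic_moment n k (A : set mtree_space) : Fn n A ->
  'E_P[fun tau => (\1_A tau * (M (n + k) tau)%:R ^+ l)%R]%E =
  (l`!%:R * \sum_(i < l.+1) \sum_(a < i.+1)
    (((moment_poly k - 1) ^+ a)`_i / (l - i)`!%:R) * mixed_moment n A i a)%:E.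
Proof.
move=> FA; have [En E0] := moment_poly_nneg k.
rewrite expectation_moment_poly// EFinM; congr (_ * _)%E.
have c0 i a : 0 <= ((moment_poly k - 1) ^+ a)`_i / (l - i)`!%:R.
  by rewrite mulr_ge0//; exact/nneg_coefX/nneg_coef_sub1.
rewrite -(expectation_mixed n (Fn_measurable FA) c0).
rewrite expectation_indicM; apply: eq_integral => x _; congr EFin.
rewrite /coefMZ coefMr; apply: eq_bigr => i _.
have il : (i <= l)%N by rewrite -ltnS.
rewrite coef_exp_poly_exp ?leq_subr//.
rewrite -[moment_poly k ^+ _]mul1r (coefM_exp_binomial 1 _ E0 (leqnn i)).
rewrite mulr_sumr; apply: eq_bigr => a _; rewrite mul1r; ring.
Qed.

End conditional_moments.

(** * Growth of the coefficients *)

Section sequences.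
Context (R : realType).
Implicit Types (x y b g : nat -> R).

Lemma cvg_sumr I (r : seq I) (Q : pred I) (F : I -> nat -> R) (a : I -> R) :
  (forall i, Q i -> F i k @[k --> \oo] --> a i) ->
  \sum_(i <- r | Q i) F i k @[k --> \oo] --> \sum_(i <- r | Q i) a i.
Proof. by apply: cvg_big; exact: add_continuous. Qed.

Lemma cvg_exprn x (a : R) n : x k @[k --> \oo] --> a -> x k ^+ n @[k --> \oo] --> a ^+ n.
Proof. 
by move=> xa; apply: (@continuous_cvg _ _ _ _ _ _ (fun t : R => t ^+ n)) => //;
   exact: exprn_continuous. Qed.

Lemma cvg_contraction (a : R) y g (g' : R) : 0 <= a < 1 ->
  (forall k, y k.+1 = a * y k + g k) -> g k @[k --> \oo] --> g' ->
  y k @[k --> \oo] --> g' / (1 - a).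
Proof.
move=> /andP[a0 a1] yS gg'; set L := g' / (1 - a).
have a1' : 0 < 1 - a by rewrite subr_gt0.
have LE : L = a * L + g' by rewrite /L; field; rewrite gt_eqF.
apply/cvgrPdist_le => e e0.
(* With this tolerance on g, e/2 is a fixed point of the error recursion: a e/2 + (1 - a) e/2 =
   e/2. *)
have e2 : 0 < e / 2 * (1 - a) by rewrite mulr_gt0// divr_gt0.
have /cvgrPdist_le/(_ _ e2)[K _ hK] := gg'.
have bnd m : `|L - y (m + K)%N| <= a ^+ m * `|L - y K| + e / 2.
  elim: m => [|m IH].
    by rewrite expr0 mul1r add0n lerDl divr_ge0// ltW.
  rewrite addSn yS {1}LE (_ : _ - _ = a * (L - y (m + K)%N) + (g' - g (m + K)%N)); last by ring.
  apply: (le_trans (ler_normD _ _)); rewrite normrM (ger0_norm a0).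
  apply: (@le_trans _ _ (a * (a ^+ m * `|L - y K| + e / 2) + e / 2 * (1 - a))).
    by rewrite lerD ?ler_wpM2l//; apply: hK => /=; exact: leq_addl.
  by rewrite exprS le_eqVlt; apply/orP; left; apply/eqP; ring.
have ea : 0 < e / 2 / (1 + `|L - y K|) by rewrite !divr_gt0// ltr_pwDl.
have := @cvg_expr R a; rewrite ger0_norm// => /(_ a1)/cvgrPdist_le/(_ _ ea)[K' _ hK'].
exists (K' + K)%N => // k /= kK.
rewrite -(subnK (leq_trans (leq_addl K' K) kK)); apply: (le_trans (bnd _)).
have := hK' (k - K)%N; rewrite /= leq_subRL ?(leq_trans (leq_addl _ _) kK)// addnC => /(_ kK).
rewrite sub0r normrN normrX ger0_norm// => ak.
rewrite {2}(splitr e) lerD2r (le_trans (ler_wpM2r _ ak))//.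
rewrite mulrAC ler_pdivrMr ?ltr_pwDl// ler_wpM2l ?lerDr//.
by rewrite divr_ge0// ltW.
Qed.

(** A Stolz-Cesaro argument: the increments of c (k+1)^(d+1) are equivalent to beta (k+1)^d, so the
    remainder e has increments del_k (k+1)^d with del_k -> 0. Bounding (i+1)^d by (k+1)^d for i <= k
    leaves a Cesaro mean of |del|, which tends to 0. *)
Lemma cvg_stolz x b d (beta : R) :
  (forall k, x k.+1 = x k + b k) ->
  b k / k.+1%:R ^+ d @[k --> \oo] --> beta ->
  x k / k.+1%:R ^+ d.+1 @[k --> \oo] --> beta / d.+1%:R.
Proof.
move=> xS bbeta; set c := beta / d.+1%:R.
have k0 k : 0 < (k.+1%:R : R) by [].
pose e k := x k - c * k.+1%:R ^+ d.+1.
pose del k := (e k.+1 - e k) / k.+1%:R ^+ d.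
have del0 : del k @[k --> \oo] --> 0.
  have -> : 0 = beta - c * \sum_(i < d.+1) (1 + 0) ^+ (d - i) :> R.
    rewrite (eq_bigr (fun=> 1)); last by move=> i _; rewrite addr0 expr1n.
    by rewrite sumr_const card_ord /c -mulr_natr mul1r divfK ?subrr// pnatr_eq0.
  rewrite (_ : del = fun k => b k / k.+1%:R ^+ d - c * \sum_(i < d.+1) (1 + harmonic k) ^+ (d - i)).
    apply: cvgB => //; apply: cvgMl_tmp; apply: cvg_sumr => i _.
    by apply: cvg_exprn; apply: cvgD; [exact: cvg_cst|exact: cvg_harmonic].
  apply/funext => k; rewrite /del /e xS.
  have kn0 : (k.+1%:R : R) != 0 by rewrite gt_eqF.
  have -> : \sum_(i < d.+1) (1 + harmonic k) ^+ (d - i) =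
      (k.+2%:R ^+ d.+1 - k.+1%:R ^+ d.+1) / k.+1%:R ^+ d :> R.
    have -> : (k.+2%:R : R) = (1 + harmonic k) * k.+1%:R.
      by rewrite /harmonic /= mulrDl mul1r mulVf// [in LHS]mulrS addrC.
    rewrite exprMn (_ : _ - _ =
      ((1 + harmonic k) ^+ d.+1 - 1 ^+ d.+1) * k.+1%:R ^+ d.+1); last first.
      by rewrite expr1n; ring.
    rewrite subrXX [in RHS](eq_bigr (fun i : 'I_d.+1 => (1 + harmonic k) ^+ (d - i))); last first.
      by move=> i _; rewrite expr1n mulr1.
    set s := \sum_(i < _) _.
    rewrite (_ : 1 + harmonic k - 1 = harmonic k); last by ring.
    rewrite [k.+1%:R ^+ d.+1]exprS /harmonic /=.
    by field; rewrite expf_neq0// addrC natr1.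
  by field; rewrite expf_neq0// addrC natr1.
have ebnd k : `|e k| <= `|e 0| + \sum_(0 <= i < k) `|del i| * i.+1%:R ^+ d.
  elim: k => [|k IH]; first by rewrite big_geq// addr0.
  rewrite big_nat_recr//= addrA; apply: le_trans (lerD IH (lexx _)).
  rewrite -[X in _ * X]ger0_norm ?exprn_ge0// -normrM /del divfK ?expf_neq0//.
  by rewrite -{1}(subrKC (e k) (e k.+1)) ler_normD.
have e_small : e k / k.+1%:R ^+ d.+1 @[k --> \oo] --> (0 : R).
  apply/norm_cvg0P.
  apply: (@squeeze_cvgr _ _ _ _ (cst 0) (fun k => `|e 0| * harmonic k +
     arithmetic_mean (fun i => `|del i|) k)); last 2 first.
  - exact: cvg_cst.
  - rewrite -[X in _ --> X]addr0 -{1}(mulr0 `|e 0|); apply: cvgD.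
      by apply: cvgMl_tmp; exact: cvg_harmonic.
    by apply: cesaro; apply/norm_cvg0P.
  near=> k; rewrite normr_ge0 /= normrM normfV [X in _ / X]ger0_norm ?exprn_ge0//.
  rewrite ler_pdivrMr ?exprn_gt0//; apply: (le_trans (ebnd k)).
  rewrite mulrDl lerD//.
    by rewrite exprS mulrA mulrVK ?unitfE// ler_peMr// exprn_ege1// ler1n.
  rewrite (_ : _ * _ = series (fun i => `|del i|) k.+1 * k.+1%:R ^+ d); last first.
    by rewrite /arithmetic_mean /= exprS; field; rewrite addrC natr1.
  rewrite /series /= mulr_suml big_nat_recr//= ler_wpDr ?mulr_ge0 ?exprn_ge0//.
  rewrite !big_nat; apply: ler_sum => i /andP[_ ik].
  by rewrite ler_wpM2l// lerXn2r ?nnegrE// ler_nat ltnW.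
rewrite (_ : (fun k => _) = fun k => c + e k / k.+1%:R ^+ d.+1).
  by rewrite -[X in _ --> X]addr0; apply: cvgD => //; exact: cvg_cst.
apply/funext => k; rewrite /e mulrBl mulfK ?expf_neq0//; ring.
Unshelve. all: by end_near. Qed.

End sequences.

(** * Convergence at scales compatible with products *)

Section scaled_convergence.
Context (R : realType).
Implicit Types (lam kap : nat -> R) (N : nat -> {poly R}) (Y : {poly R}).

(* The coefficient of degree [i] of [N k] is compared with [lam k ^+ i * kap k]:
   these scales are compatible with products of polynomials. *)
Definition scaled_cvg (lam kap : nat -> R) (N : nat -> {poly R}) (Y : {poly R}) (i : nat) :=
  (N k)`_i / (lam k ^+ i * kap k) @[k --> \oo] --> Y`_i.

(** The two alternatives with a vanishing factor ask nothing of the other factor: in an induction on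
    the degree, its convergence is not yet known there. *)
Lemma scaled_cvgM_gen lam kap kap' N N' Y Y' j :
  (forall i, (i <= j)%N ->
     (scaled_cvg lam kap N Y i /\ scaled_cvg lam kap' N' Y' (j - i)) \/
     ((forall k, (N k)`_i = 0) /\ Y`_i = 0) \/
     ((forall k, (N' k)`_(j - i) = 0) /\ Y'`_(j - i) = 0)) ->
  scaled_cvg lam (fun k => kap k * kap' k) (fun k => N k * N' k) (Y * Y') j.
Proof.
move=> h; rewrite /scaled_cvg.
rewrite (_ : (fun k => _) = fun k => \sum_(i < j.+1)
    ((N k)`_i / (lam k ^+ i * kap k)) * ((N' k)`_(j - i) / (lam k ^+ (j - i) * kap' k))).
  rewrite coefM; apply: cvg_sumr => i _.
  have [[c1 c2]|[[z1 z2]|[z1 z2]]] := h i (leq_ord i).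
  - exact: cvgM.
  - rewrite z2 mul0r (_ : (fun k => _) = cst 0); first exact: cvg_cst.
    by apply/funext => k; rewrite z1 !mul0r.
  - rewrite z2 mulr0 (_ : (fun k => _) = cst 0); first exact: cvg_cst.
    by apply/funext => k; rewrite z1 mul0r mulr0.
apply/funext => k; rewrite coefM mulr_suml; apply: eq_bigr => i _.
rewrite -[in lam k ^+ j](subnKC (leq_ord i)) exprD.
by rewrite mulf_div; congr (_ / _); rewrite mulrACA.
Qed.

Lemma scaled_cvgM lam kap kap' N N' Y Y' j :
  (forall i, (i <= j)%N -> scaled_cvg lam kap N Y i) ->
  (forall i, (i <= j)%N -> scaled_cvg lam kap' N' Y' i) ->
  scaled_cvg lam (fun k => kap k * kap' k) (fun k => N k * N' k) (Y * Y') j.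
Proof.
move=> h h'; apply: scaled_cvgM_gen => i ij; left.
by split; [exact: h|apply: h'; exact: leq_subr].
Qed.

Lemma scaled_cvgX lam kap N Y a j :
  (forall i, (i <= j)%N -> scaled_cvg lam kap N Y i) ->
  forall i, (i <= j)%N ->
  scaled_cvg lam (fun k => kap k ^+ a) (fun k => N k ^+ a) (Y ^+ a) i.
Proof.
move=> h; elim: a => [|a IH] i ij.
  rewrite /scaled_cvg (_ : (fun k => _) = cst (i == 0)%:R).
    by rewrite expr0 coef1; exact: cvg_cst.
  apply/funext => k; rewrite !expr0 coef1 mulr1 /=.
  by case: i ij => [|i] _ /=; rewrite ?expr0 ?divr1 ?mul0r.
rewrite (_ : (fun k => kap k ^+ a.+1) = fun k => kap k * kap k ^+ a); last first.
  by apply/funext => k; rewrite exprS.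
rewrite (_ : (fun k => N k ^+ a.+1) = fun k => N k * N k ^+ a); last first.
  by apply/funext => k; rewrite exprS.
rewrite exprS; apply: scaled_cvgM => i' i'i; [apply: h|apply: IH].
  exact: leq_trans i'i ij.
exact: leq_trans i'i ij.
Qed.

Lemma coef0_exp (N : {poly R}) a : N`_0 = 0 -> (N ^+ a.+1)`_0 = 0.
Proof. by move=> N0; apply: coef_exp_lt. Qed.

(* Without constant terms, the powers at least 2 only involve coefficients of
   smaller degree. *)
Lemma scaled_cvgX2 lam kap N Y a j :
  (forall k, (N k)`_0 = 0) -> Y`_0 = 0 ->
  (forall i, (i < j)%N -> scaled_cvg lam kap N Y i) ->
  scaled_cvg lam (fun k => kap k ^+ a.+2) (fun k => N k ^+ a.+2) (Y ^+ a.+2) j.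
Proof.
move=> N0 Y0 h.
rewrite (_ : (fun k => kap k ^+ a.+2) = fun k => kap k * kap k ^+ a.+1); last first.
  by apply/funext => k; rewrite exprS.
rewrite (_ : (fun k => N k ^+ a.+2) = fun k => N k * N k ^+ a.+1); last first.
  by apply/funext => k; rewrite exprS.
rewrite exprS; apply: scaled_cvgM_gen => i ij.
have [->|i0] := posnP i; first by right; left.
move: ij; rewrite leq_eqVlt => /orP[/eqP->|ij].
  by right; right; rewrite subnn coef0_exp//; split=> // k; rewrite coef0_exp.
left; split; first exact: h.
have ji : (j - i < j)%N by rewrite ltn_subrL i0 (leq_ltn_trans _ ij).
apply: (scaled_cvgX _ (leqnn _)) => i' i'ji; apply: h.
exact: leq_ltn_trans i'ji ji.
Qed.

(** As [N'] has no constant term, [N ^+ a] enters in degrees below j only. It serves with [N'] the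
    constant sequence e^s - 1. *)
Lemma scaled_cvgMX lam kap kap' N N' Y Y' a j :
  (forall k, (N' k)`_0 = 0) -> Y'`_0 = 0 ->
  (forall i, (i <= j)%N -> scaled_cvg lam kap' N' Y' i) ->
  (forall i, (i < j)%N -> scaled_cvg lam kap N Y i) ->
  scaled_cvg lam (fun k => kap' k * kap k ^+ a) (fun k => N' k * N k ^+ a) (Y' * Y ^+ a) j.
Proof.
move=> N0 Y0 h' h; apply: scaled_cvgM_gen => i ij.
have [->|i0] := posnP i; first by right; left.
left; split; first exact: h'.
have [j0|j0] := posnP j; first by move: ij i0; rewrite j0 leqn0 => /eqP->.
have ji : (j - i < j)%N by rewrite ltn_subrL i0.
apply: (scaled_cvgX _ (leqnn _)) => i' i'ji; apply: h.
exact: leq_ltn_trans i'ji ji.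
Qed.

End scaled_convergence.

(** * The recursion on the coefficients *)

Section recursion.
Context (R : realType) (p q : nat -> R) (l : nat).
Hypothesis (hp : offspring_distribution p) (hl : (moment p l < +oo)%E)
  (hq : mark_function q).

Definition factorial_moment (a : nat) : R :=
  binomial_moment p q false a + binomial_moment p q true a.

Let N k : {poly R} := moment_poly p q l k - 1.
Let U : {poly R} := exp_poly R l - 1.

(** Writing e^s = 1 + U, T(1 + N) is the sum of the f_a N^a, with f_a the factorial moments divided
    by a!, plus the sum of the b_a U N^a. In degree j > 0 the term f_0 disappears and f_1 N is the
    linear part; the rest is kept here. The terms a = 0, 1 remain in the second sum since U has no
    constant term. *)
Definition lower_part (j k : nat) : R :=
  \sum_(a < l.-1) factorial_moment a.+2 * (N k ^+ a.+2)`_j +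
  \sum_(a < l.+1) binomial_moment p q true a * (U * N k ^+ a)`_j.

Lemma moment_poly_coefS j k : (0 < j <= l)%N ->
  (N k.+1)`_j = factorial_moment 1 * (N k)`_j + lower_part j k.
Proof.
move=> /andP[j0 jl]; rewrite {1}/N coefB coef1 gtn_eqF// subr0 /= /step_op coef_sum.
rewrite (eq_bigr (fun a : 'I_l.+1 => factorial_moment a * (N k ^+ a)`_j +
   binomial_moment p q true a * (U * N k ^+ a)`_j)); last first.
  move=> a _; rewrite -/(moment_poly p q l k) -/(N k) /factorial_moment /U.
  rewrite -!coefCM -coefD; congr (coefp j _).
  by rewrite -!mul_polyC polyCD; ring.
rewrite big_split/= /lower_part addrA; congr (_ + _).
case: l j0 jl => [|l'] j0 jl; first by rewrite leqn0 gtn_eqF in jl.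
by rewrite big_ord_recl big_ord_recl /= expr0 coef1 gtn_eqF// mulr0 add0r expr1.
Qed.

(** The normalization lam^j kap^2 is that of N^2, the lowest nonlinear power; N^(a+2) then keeps a
    factor kap^a, which tends to kap'^a. When kap' = 0, only a = 0 survives. [V] is what remains of
    U at the same scale. *)
Lemma lower_part_cvg (lam kap : nat -> R) (kap' : R) (Y V : {poly R}) j :
  (forall k, lam k != 0) -> (forall k, kap k != 0) ->
  kap k @[k --> \oo] --> kap' -> Y`_0 = 0 -> V`_0 = 0 ->
  (forall i, (i < j)%N -> scaled_cvg lam kap N Y i) ->
  (forall i, (i <= j)%N -> scaled_cvg lam (fun k => kap k ^+ 2) (fun=> U) V i) ->
  lower_part j k / (lam k ^+ j * kap k ^+ 2) @[k --> \oo] -->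
  \sum_(a < l.-1) factorial_moment a.+2 * (kap' ^+ a * (Y ^+ a.+2)`_j) +
  \sum_(a < l.+1) binomial_moment p q true a * (kap' ^+ a * (V * Y ^+ a)`_j).
Proof.
move=> lam0 kap0 kapc Y0 V0 hN hU.
have N0 k : (N k)`_0 = 0.
  by have [_ E0] := moment_poly_nneg hp hl hq k; rewrite coefB coef1 E0 subrr.
have U0 : U`_0 = 0 by rewrite coefB coef1 coef_exp_poly// fact0 invr1 subrr.
rewrite (_ : (fun k => _) = fun k =>
  \sum_(a < l.-1) factorial_moment a.+2 * (kap k ^+ a *
     ((N k ^+ a.+2)`_j / (lam k ^+ j * kap k ^+ a.+2))) +
  \sum_(a < l.+1) binomial_moment p q true a * (kap k ^+ a *
     ((U * N k ^+ a)`_j / (lam k ^+ j * (kap k ^+ 2 * kap k ^+ a))))).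
  apply: cvgD; apply: cvg_sumr => a _; apply: cvgMl_tmp; apply: cvgM.
  - exact: cvg_exprn.
  - exact: scaled_cvgX2.
  - exact: cvg_exprn.
  - exact: scaled_cvgMX.
apply/funext => k; rewrite /lower_part mulrDl !mulr_suml; congr (_ + _).
  apply: eq_bigr => a _; rewrite -mulrA; congr (_ * _).
  have -> : kap k ^+ a.+2 = kap k ^+ a * kap k ^+ 2 by rewrite -exprD addn2.
  by field; rewrite !expf_neq0// ?lam0 ?kap0.
apply: eq_bigr => a _; rewrite -mulrA; congr (_ * _).
by field; rewrite !expf_neq0// ?lam0 ?kap0.
Qed.

End recursion.

Lemma scaled_cvg_ge0 (R : realType) (lam kap : nat -> R) (N : nat -> {poly R}) Y i :
  (forall k, 0 < lam k) -> (forall k, 0 < kap k) -> (forall k, nneg_coef (N k)) ->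
  scaled_cvg lam kap N Y i -> 0 <= Y`_i.
Proof.
move=> lam_gt0 kap_gt0 N0 c; have cc := cvgP _ c.
rewrite -(cvg_lim (@Rhausdorff R) c).
apply: limr_ge => //; near=> k.
by rewrite mulr_ge0// ?N0// invr_ge0 mulr_ge0// ?exprn_ge0// ltW.
Unshelve. all: by end_near. Qed.

Section growth.
Context (R : realType) (p q : nat -> R) (l : nat) (mu : R).
Hypothesis (hp : offspring_distribution p) (hl : (moment p l < +oo)%E)
  (hq : mark_function q) (p01 : p 0%N + p 1%N < 1) (hmu : moment p 1 = mu%:E)
  (hpq : exists k, 0 < p k * q k) (l_gt0 : (0 < l)%N).

Local Notation N := (fun k => moment_poly p q l k - 1).
Let U : {poly R} := exp_poly R l - 1.

Lemma p0D k : p0 p q k false + p0 p q k true = p k.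
Proof. by rewrite /p0; ring. Qed.

Lemma factorial_momentE a : (a <= l)%N ->
  (\sum_(0 <= k <oo) (p k * 'C(k, a)%:R)%:E)%E = (factorial_moment p q a)%:E.
Proof.
move=> al; rewrite /factorial_moment EFinD -!(binomial_momentE hp hl hq _ al).
rewrite -nneseriesD; last 2 first.
- by move=> k _ _; rewrite lee_fin mulr_ge0// p0_ge0.
- by move=> k _ _; rewrite lee_fin mulr_ge0// p0_ge0.
by apply: eq_eseriesr => k _; rewrite -EFinD -mulrDl p0D.
Qed.

Lemma factorial_moment1 : factorial_moment p q 1 = mu.
Proof.
apply/EFin_inj; rewrite -factorial_momentE// -hmu.
by apply: eq_eseriesr => k _; rewrite bin1 expr1 mulrC.
Qed.

Lemma factorial_moment_ge0 a : 0 <= factorial_moment p q a.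
Proof. by rewrite addr_ge0// binomial_moment_ge0. Qed.

Lemma mu_ge0 : 0 <= mu.
Proof. by rewrite -factorial_moment1 factorial_moment_ge0. Qed.

(** This is the probability that a node is marked. *)
Lemma binomial_moment_true0_gt0 : 0 < binomial_moment p q true 0.
Proof.
have [k pqk] := hpq; rewrite -lte_fin -(binomial_momentE hp hl hq)//.
apply: (@lt_le_trans _ _ (p0 p q k true * 'C(k, 0)%:R)%:E).
  by rewrite lte_fin bin0 mulr1.
rewrite (nneseriesD1 (n := k))//; last by move=> i _; rewrite lee_fin mulr_ge0// p0_ge0.
rewrite leeDl//; apply: nneseries_ge0 => i _ _.
by rewrite lee_fin mulr_ge0// p0_ge0.
Qed.

(** Some k >= 2 has positive mass because p(0) + p(1) < 1; the condition on l makes the moment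
    finite, so that [fine] is faithful. *)
Lemma factorial_moment2_gt0 : (1 < l)%N -> 0 < factorial_moment p q 2.
Proof.
move=> l1; have [k k2 pk] : exists2 k, (1 < k)%N & 0 < p k.
  apply: contrapT => h; move: p01; rewrite -lte_fin.
  rewrite -[X in (_ < X)%E](offspring_sum1 hp) EFinD.
  have pk0 k : (1 < k)%N -> p k = 0.
    move=> k1; apply/eqP; rewrite eq_le (offspring_ge0 hp) andbT leNgt.
    by apply/negP => pk; apply: h; exists k.
  rewrite (nneseries_split _ 2)//; last by move=> k _; rewrite lee_fin (offspring_ge0 hp).
  rewrite add0n !big_nat_recl//= big_geq// adde0 eseries0 ?adde0 ?ltxx//.
  by move=> i i2 _; rewrite pk0.
rewrite -lte_fin -factorial_momentE//.
apply: (@lt_le_trans _ _ (p k * 'C(k, 2)%:R)%:E).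
  by rewrite lte_fin mulr_gt0// ltr0n bin_gt0.
rewrite (nneseriesD1 (n := k))//; last by move=> i _; rewrite lee_fin mulr_ge0// (offspring_ge0 hp).
rewrite leeDl//; apply: nneseries_ge0 => i _ _.
by rewrite lee_fin mulr_ge0// (offspring_ge0 hp).
Qed.

Lemma N_coef0 k : (N k)`_0 = 0.
Proof. by have [_ E0] := moment_poly_nneg hp hl hq k; rewrite coefB coef1 E0 subrr. Qed.

Lemma N_nneg k : nneg_coef (N k).
Proof. by have [En E0] := moment_poly_nneg hp hl hq k; exact: nneg_coef_sub1. Qed.

Lemma U_coef0 : U`_0 = 0.
Proof. by rewrite coefB coef1 coef_exp_poly// fact0 invr1 subrr. Qed.

Lemma U_coef i : (0 < i <= l)%N -> U`_i = i`!%:R^-1.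
Proof. by case/andP=> i0 il; rewrite coefB coef1 gtn_eqF// subr0 coef_exp_poly. Qed.

Lemma U_nneg : nneg_coef U.
Proof.
apply: nneg_coef_sub1; first exact: exp_poly_nneg.
by rewrite coef_exp_poly// fact0 invr1.
Qed.

Section scales.
Variables (lam kap : nat -> R).
Hypothesis (lam_gt0 : forall k, 0 < lam k) (kap_gt0 : forall k, 0 < kap k).

(** Defined outright through [limn], so that the induction on the degree deals with a fixed
    polynomial instead of building its coefficients one by one. *)
Definition scaled_limit : {poly R} :=
  \poly_(i < l.+1) limn (fun k => (N k)`_i / (lam k ^+ i * kap k)).

Lemma scaled_limitP i (y : R) : (i <= l)%N ->
  (N k)`_i / (lam k ^+ i * kap k) @[k --> \oo] --> y ->
  scaled_cvg lam kap N scaled_limit i /\ scaled_limit`_i = y.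
Proof.
move=> il c; have e : scaled_limit`_i = y.
  by rewrite coef_poly ltnS il; exact: (cvg_lim (@Rhausdorff R) c).
by split => //; rewrite /scaled_cvg e.
Qed.

Lemma scaled_limit0 : scaled_cvg lam kap N scaled_limit 0 /\ scaled_limit`_0 = 0.
Proof.
apply: scaled_limitP => //; rewrite (_ : (fun k => _) = cst 0); first exact: cvg_cst.
by apply/funext => k; rewrite N_coef0 mul0r.
Qed.

Definition lower_limit (kap' : R) (Y V : {poly R}) (j : nat) : R :=
  \sum_(a < l.-1) factorial_moment p q a.+2 * (kap' ^+ a * (Y ^+ a.+2)`_j) +
  \sum_(a < l.+1) binomial_moment p q true a * (kap' ^+ a * (V * Y ^+ a)`_j).

(** Every term is nonnegative, being a limit of nonnegative quantities; all but the term a = 0 of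
    one sum are dropped. These two bounds provide the positivity of the limits. *)
Lemma lower_limit_ge (kap' : R) (Y V : {poly R}) j : 0 <= kap' -> Y`_0 = 0 -> V`_0 = 0 ->
  (forall i, (i < j)%N -> scaled_cvg lam kap N Y i) ->
  (forall i, (i <= j)%N -> scaled_cvg lam (fun k => kap k ^+ 2) (fun=> U) V i) ->
  ((1 < l)%N -> factorial_moment p q 2 * (Y ^+ 2)`_j <= lower_limit kap' Y V j) /\
  binomial_moment p q true 0 * V`_j <= lower_limit kap' Y V j.
Proof.
move=> kap'0 Y0 V0 hN hU.
have t1 a : 0 <= factorial_moment p q a.+2 * (kap' ^+ a * (Y ^+ a.+2)`_j).
  rewrite mulr_ge0 ?factorial_moment_ge0// mulr_ge0 ?exprn_ge0//.
  have /(scaled_cvg_ge0 lam_gt0) := scaled_cvgX2 (a := a) N_coef0 Y0 hN.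
  apply => k.
    exact: exprn_gt0.
  exact/nneg_coefX/N_nneg.
have t2 a : 0 <= binomial_moment p q true a * (kap' ^+ a * (V * Y ^+ a)`_j).
  rewrite mulr_ge0 ?binomial_moment_ge0// mulr_ge0 ?exprn_ge0//.
  have /(scaled_cvg_ge0 lam_gt0) := scaled_cvgMX (a := a) (fun=> U_coef0) V0 hU hN.
  apply => k.
    by rewrite mulr_gt0 ?exprn_gt0.
  by apply: nneg_coefM; [exact: U_nneg|exact/nneg_coefX/N_nneg].
split=> [l1|]; rewrite /lower_limit.
  case: l l1 => [//|[//|l']] _ /=.
  by rewrite [X in _ <= X + _]big_ord_recl /= mul1r -addrA lerDl addr_ge0// sumr_ge0.
rewrite [X in _ <= _ + X]big_ord_recl /= mul1r mulr1 addrCA lerDl addr_ge0//.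
  exact: sumr_ge0.
exact: sumr_ge0.
Qed.

(* The coefficients of degree [j] satisfy a linear recursion whose forcing term
   [lower_part] only involves smaller degrees. *)
Lemma scaled_limit_induction (kap' : R) (V : {poly R}) :
  0 <= kap' -> kap k @[k --> \oo] --> kap' -> V`_0 = 0 ->
  (forall i, (i <= l)%N -> scaled_cvg lam (fun k => kap k ^+ 2) (fun=> U) V i) ->
  (forall j (beta : R), (0 < j <= l)%N ->
     lower_part p q l j k / (lam k ^+ j * kap k ^+ 2) @[k --> \oo] --> beta ->
     ((1 < j)%N -> factorial_moment p q 2 * (scaled_limit ^+ 2)`_j <= beta) ->
     binomial_moment p q true 0 * V`_j <= beta ->
     ((1 < j)%N -> 0 < (scaled_limit ^+ 2)`_j) ->
     exists2 y : R, 0 < y & (N k)`_j / (lam k ^+ j * kap k) @[k --> \oo] --> y) ->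
  forall j, (j <= l)%N ->
    scaled_cvg lam kap N scaled_limit j /\ ((0 < j)%N -> 0 < scaled_limit`_j).
Proof.
move=> kap'0 kapc V0 hU step; elim/ltn_ind => j IH jl.
have [->|j0] := posnP j; first by have [c e] := scaled_limit0; split.
have [_ Y0] := scaled_limit0.
have hN i : (i < j)%N -> scaled_cvg lam kap N scaled_limit i.
  by move=> ij; have [] := IH i ij (leq_trans (ltnW ij) jl).
have hU' i : (i <= j)%N -> scaled_cvg lam (fun k => kap k ^+ 2) (fun=> U) V i.
  by move=> ij; apply: hU; exact: leq_trans ij jl.
have pos i : (0 < i < j)%N -> 0 < scaled_limit`_i.
  by move=> /andP[i0 ij]; have [_ ->] := IH i ij (leq_trans (ltnW ij) jl).
have [ge1 ge2] := lower_limit_ge kap'0 Y0 V0 hN hU'.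
have [|||||y y0 c] := step j (lower_limit kap' scaled_limit V j).
- by rewrite j0.
- apply: (lower_part_cvg hp hl hq _ _ kapc Y0 V0 hN hU') => k.
    by rewrite gt_eqF.
  by rewrite gt_eqF.
- by move=> j1; apply: ge1; exact: leq_trans j1 jl.
- exact: ge2.
- move=> j1; rewrite expr2 coefM.
  have t0 (i : 'I_j.+1) : 0 <= scaled_limit`_i * scaled_limit`_(j - i).
    have [->|i0] := posnP i; first by rewrite Y0 mul0r.
    have [ij|ji] := ltnP i j; last first.
      have -> : (i = j :> nat) by apply/eqP; rewrite eqn_leq ji -ltnS ltn_ord.
      by rewrite subnn Y0 mulr0.
    by rewrite mulr_ge0// ltW// pos// ?i0// subn_gt0 ij ltn_subrL i0.
  (* The term Y_1 Y_(j-1) is positive by induction, both indices lying strictly between 0 and j. *)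
  rewrite (bigD1 (inord 1)) //= ltr_wpDr ?sumr_ge0// inordK ?ltnS//.
  by rewrite mulr_gt0// pos// ?j1// subn_gt0 j1 ltn_subrL.
have [cc e] := scaled_limitP jl c.
by split=> // _; rewrite e.
Qed.

End scales.

End growth.

(** * Growth in the three regimes *)

Section regimes.
Context (R : realType) (p q : nat -> R) (l : nat) (mu : R).
Hypothesis (hp : offspring_distribution p) (hl : (moment p l < +oo)%E)
  (hq : mark_function q) (p01 : p 0%N + p 1%N < 1) (hmu : moment p 1 = mu%:E)
  (hpq : exists k, 0 < p k * q k) (l_gt0 : (0 < l)%N).

Local Notation N := (fun k => moment_poly p q l k - 1).
Local Notation U := (exp_poly R l - 1 : {poly R}).

Lemma N_coefS j k : (0 < j <= l)%N ->
  (N k.+1)`_j = mu * (N k)`_j + lower_part p q l j k.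
Proof. by move=> jl; rewrite moment_poly_coefS// (factorial_moment1 hp hl hq hmu). Qed.

(** Dividing by nu^(jk) turns the recursion into one of ratio mu / nu^j < 1. It serves with nu = 1
    if mu < 1, and with nu = mu, j >= 2 if mu > 1. *)
Lemma geometric_step (nu : R) j (beta : R) : 0 < nu -> (0 < j <= l)%N -> mu < nu ^+ j ->
  lower_part p q l j k / ((nu ^+ k) ^+ j * 1 ^+ 2) @[k --> \oo] --> beta ->
  (N k)`_j / ((nu ^+ k) ^+ j * 1) @[k --> \oo] --> beta / (nu ^+ j - mu).
Proof.
move=> nu0 jl munu c; have nuj0 : 0 < nu ^+ j by rewrite exprn_gt0.
have -> : beta / (nu ^+ j - mu) = (nu ^+ j)^-1 * beta / (1 - mu / nu ^+ j).
  by field; rewrite !subr_eq0 !gt_eqF.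
apply: (@cvg_contraction _ _ _ (fun k => (nu ^+ j)^-1 *
  (lower_part p q l j k / ((nu ^+ k) ^+ j * 1 ^+ 2)))).
- by rewrite divr_ge0 ?(ltW nuj0) ?(mu_ge0 hp hl hq hmu l_gt0)// ltr_pdivrMr ?mul1r.
- move=> k; rewrite N_coefS// exprS exprMn; field.
  by rewrite !expf_neq0// gt_eqF.
- exact: cvgMl_tmp.
Qed.

(** With constant scales the marks do not fade: V = U, and U_j > 0 gives positivity in every
    positive degree. *)
Lemma subcritical_limit : mu < 1 ->
  forall j, (j <= l)%N ->
    scaled_cvg (fun=> 1) (fun=> 1) N (scaled_limit p q l (fun=> 1) (fun=> 1)) j /\
    ((0 < j)%N -> 0 < (scaled_limit p q l (fun=> 1) (fun=> 1))`_j).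
Proof.
move=> mu1; apply: (scaled_limit_induction hp hl hq _ _ ler01 (cvg_cst _) (U_coef0 R l)) => //.
  move=> i il; rewrite /scaled_cvg; under eq_fun do rewrite !expr1n mulr1 divr1.
  exact: cvg_cst.
move=> j beta /andP[j0 jl] c _ ge2 _.
have := @geometric_step 1 j beta ltr01; rewrite j0 jl expr1n => /(_ isT mu1).
rewrite (_ : (fun k => lower_part _ _ _ _ _ / _) =
  (fun k => lower_part p q l j k / (1 ^+ j * 1 ^+ 2))); last by apply/funext => k; rewrite !expr1n.
move=> /(_ c) cN; exists (beta / (1 - mu)).
  rewrite divr_gt0 ?subr_gt0//; apply: lt_le_trans ge2.
  rewrite mulr_gt0 ?(binomial_moment_true0_gt0 hp hl hq)// U_coef ?j0//.
by rewrite (_ : (fun k => _) = (fun k => (N k)`_j / ((1 ^+ k) ^+ j * 1)))//;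
  apply/funext => k; rewrite !expr1n.
Qed.

(** U is negligible against mu^(ik), so V = 0 and positivity for j >= 2 comes from the quadratic
    term. Degree 1 is resonant, mu being the growth rate itself: there the forcing is constant and
    the recursion is solved explicitly. *)
Lemma supercritical_limit : 1 < mu ->
  forall j, (j <= l)%N ->
    scaled_cvg (fun k => mu ^+ k) (fun=> 1) N (scaled_limit p q l (fun k => mu ^+ k) (fun=> 1)) j /\
    ((0 < j)%N -> 0 < (scaled_limit p q l (fun k => mu ^+ k) (fun=> 1))`_j).
Proof.
move=> mu1; have mu0 : 0 < mu by exact: lt_trans mu1.
have imu : `|mu^-1| < 1 by rewrite ger0_norm ?invr_ge0 ?ltW// invf_lt1.
have lam_gt0 k : 0 < mu ^+ k by rewrite exprn_gt0.
apply: (scaled_limit_induction hp hl hq lam_gt0 _ ler01 (cvg_cst _) (coef0 _ 0)) => //.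
  move=> i il; rewrite /scaled_cvg coef0.
  have [->|i0] := posnP i.
    rewrite (_ : (fun k => _) = cst 0); first exact: cvg_cst.
    by apply/funext => k; rewrite U_coef0 mul0r.
  rewrite (_ : (fun k => _) = fun k => U`_i * (mu^-1 ^+ k) ^+ i); last first.
    by apply/funext => k; rewrite expr1n mulr1 !exprVn.
  rewrite [X in _ --> X](_ : 0 = U`_i * 0 ^+ i); last by rewrite expr0n gtn_eqF// mulr0.
  by apply: cvgMl_tmp; apply: cvg_exprn; exact: cvg_expr.
move=> j beta /andP[j0 jl] c ge1 _ Y2.
move: j0; rewrite leq_eqVlt => /orP[/eqP j1|j1]; last first.
  exists (beta / (mu ^+ j - mu)); last first.
    by apply: geometric_step => //; rewrite ?jl ?(ltnW j1)// -[ltLHS]expr1 ltr_eXn2l.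
  rewrite divr_gt0 ?subr_gt0//; last by rewrite -[ltLHS]expr1 ltr_eXn2l.
  apply: lt_le_trans (ge1 j1); rewrite mulr_gt0 ?Y2//.
  by apply: (factorial_moment2_gt0 hp hl hq p01); exact: leq_trans jl.
set b := binomial_moment p q true 0.
have b0 : 0 < b by exact: (binomial_moment_true0_gt0 hp hl hq).
have lowE k : lower_part p q l 1 k = b.
  have N0 := N_coef0 hp hl hq k.
  rewrite /lower_part big1 ?add0r; last first.
    by move=> a _; rewrite coef_exp_lt// mulr0.
  rewrite big_ord_recl expr0 mulr1 U_coef// factS fact0 muln1 invr1 mulr1 big1 ?addr0// => a _.
  rewrite coefM big_ord_recr big_ord1 /= U_coef0 mul0r add0r subnn.
  by rewrite coef_exp_lt ?mulr0.
have N1 k : (N k)`_1 = b * (mu ^+ k - 1) / (mu - 1).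
  elim: k => [|k IH]; first by rewrite subrr coef0 expr0 subrr mulr0 mul0r.
  rewrite N_coefS// IH lowE exprS; field.
  by rewrite subr_eq0 gt_eqF.
exists (b / (mu - 1)); first by rewrite divr_gt0// subr_gt0.
rewrite -j1 (_ : (fun k => _) = fun k => b / (mu - 1) * (1 - mu^-1 ^+ k)); last first.
  apply/funext => k; rewrite N1 expr1 exprVn; field.
  by rewrite subr_eq0 !gt_eqF.
rewrite -[X in _ --> X]mulr1; apply: cvgMl_tmp.
rewrite [X in _ --> X](_ : 1 = 1 - 0); last by rewrite subr0.
by apply: cvgB; [exact: cvg_cst|exact: cvg_expr].
Qed.

(** The forcing of order lam^j kap^2 = (k+1)^(2j-2) is summed, giving (k+1)^(2j-1) and the factor
    1/(2j-1). Only the coefficient U_1 = 1 is not negligible, hence V = X, which starts the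
    positivity in degree 1; the quadratic term propagates it. *)
Lemma critical_limit : mu = 1 ->
  forall j, (j <= l)%N ->
    scaled_cvg (fun k => k.+1%:R ^+ 2) harmonic N
      (scaled_limit p q l (fun k => k.+1%:R ^+ 2) harmonic) j /\
    ((0 < j)%N -> 0 < (scaled_limit p q l (fun k => k.+1%:R ^+ 2) harmonic)`_j).
Proof.
move=> mu1; have kn0 k : k.+1%:R != 0 :> R by [].
have lam_gt0 k : 0 < k.+1%:R ^+ 2 :> R by rewrite exprn_gt0.
have kap_gt0 k : 0 < harmonic k :> R by rewrite /harmonic /=.
have scaleE j k : (0 < j)%N ->
  (k.+1%:R ^+ 2) ^+ j * harmonic k ^+ 2 = k.+1%:R ^+ (j.-1.*2) :> R.
  case: j => // j _; rewrite exprSr /harmonic /= -exprM mul2n; field.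
  by rewrite addrC natr1.
have X0 : ('X : {poly R})`_0 = 0 by rewrite coefX.
apply: (scaled_limit_induction hp hl hq lam_gt0 kap_gt0 (lexx 0) (@cvg_harmonic R) X0) => //.
  move=> i il; rewrite /scaled_cvg coefX.
  have [->|i0] := posnP i.
    rewrite (_ : (fun k => _) = cst 0); first exact: cvg_cst.
    by apply/funext => k; rewrite U_coef0 mul0r.
  rewrite (_ : (fun k => _) = fun k => U`_i * harmonic k ^+ (i.-1.*2)); last first.
    by apply/funext => k; rewrite scaleE// exprVn.
  have -> : (i == 1)%:R = U`_i * 0 ^+ (i.-1.*2) :> R.
    rewrite U_coef ?i0//; case: i i0 il => [//|[|i]] _ _ /=.
      by rewrite expr0 invr1 mulr1.
    by rewrite expr0n mulr0.
  by apply: cvgMl_tmp; apply: cvg_exprn; exact: cvg_harmonic.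
move=> j beta /andP[j0 jl] c ge1 ge2 Y2.
exists (beta / (j.-1.*2.+1)%:R); last first.
  rewrite (_ : (fun k => _) = fun k => (N k)`_j / k.+1%:R ^+ (j.-1.*2.+1)); last first.
    apply/funext => k; congr (_ / _); rewrite [in RHS]exprS -scaleE// /harmonic /=.
    by field; rewrite addrC natr1.
  apply: (@cvg_stolz _ _ (lower_part p q l j)).
    by move=> k; rewrite N_coefS ?j0// mu1 mul1r.
  rewrite (_ : (fun k => _) = fun k =>
    lower_part p q l j k / ((k.+1%:R ^+ 2) ^+ j * harmonic k ^+ 2))//.
  by apply/funext => k; rewrite scaleE.
rewrite divr_gt0//; have [j1|j1] := ltnP 1 j.
  apply: lt_le_trans (ge1 j1); rewrite mulr_gt0 ?Y2//.
  by apply: (factorial_moment2_gt0 hp hl hq p01); exact: leq_trans jl.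
apply: lt_le_trans ge2; rewrite (_ : j = 1%N); last by apply/eqP; rewrite eqn_leq j1.
by rewrite coefX mulr1 (binomial_moment_true0_gt0 hp hl hq).
Qed.

End regimes.

(** * Limits of the penalized ratios *)

Section ratio.
Context (R : realType) (p q : nat -> R) (l : nat).
Hypothesis (hp : offspring_distribution p) (hl : (moment p l < +oo)%E)
  (hq : mark_function q) (l_gt0 : (0 < l)%N).
Context (P : probability mtree_space R) (hP : marked_GW p q P).

Local Notation N := (fun k => moment_poly p q l k - 1).

(* The case a = 0 < i is excluded because the coefficient of degree i of N^0 = 1
   vanishes. *)
Lemma penalized_ratio_cvg (lam kap : nat -> R) (rho : R) (gam : nat -> nat -> R)
    (Y : {poly R}) (g : nat -> nat -> R) n (A : set mtree_space) :
  (forall k, 0 < lam k) -> (forall k, 0 < kap k) -> 0 < rho ->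
  (forall i a, 0 <= gam i a) -> 0 < Y`_l ->
  (forall i, (i <= l)%N -> scaled_cvg lam kap N Y i) ->
  lam (n + k)%N ^+ l * kap (n + k)%N / (lam k ^+ l * kap k) @[k --> \oo] --> rho ->
  (forall i a, (a <= i <= l)%N -> (a == 0%N) ==> (i == 0%N) ->
     lam k ^+ i * kap k ^+ a / (lam k ^+ l * kap k) @[k --> \oo] --> gam i a) ->
  (forall m z, g m z = \sum_(i < l.+1) \sum_(a < i.+1)
     (Y ^+ a)`_i * gam i a / (l - i)`!%:R / (Y`_l * rho) *
     (m%:R ^+ (l - i) * 'C(z, a)%:R)) ->
  Fn n A ->
  penalized_ratio P l n A k @[k --> \oo] -->
    'E_P[(fun tau => \1_A tau * g (M n tau) (Z n tau))%R]%E.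
Proof.
move=> lam0 kap0 rho0 gam0 Yl0 hN hrho hgam gE FA.
have f0 j : j`!%:R != 0 :> R by rewrite pnatr_eq0 -lt0n fact_gt0.
have s0 k : 0 < lam k ^+ l * kap k by rewrite mulr_gt0 ?exprn_gt0.
have Ya0 i a : (i <= l)%N -> 0 <= (Y ^+ a)`_i.
  move=> il; have /(scaled_cvg_ge0 lam0) := scaled_cvgX (a := a) hN il.
  by apply=> k; [exact: exprn_gt0|exact/nneg_coefX/N_nneg].
pose c i a := (Y ^+ a)`_i * gam i a / (l - i)`!%:R / (Y`_l * rho).
(* [expectation_mixed] asks for nonnegativity at all indices, whereas that of [c] is known only for
   i <= l. *)
pose c' i a := if (i <= l)%N then c i a else 0.
have c'0 i a : 0 <= c' i a.
  rewrite /c'; case: ifP => // il; rewrite /c divr_ge0 ?mulr_ge0 ?Ya0 ?invr_ge0//.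
    exact: ltW.
  exact: ltW.
have -> : 'E_P[(fun tau => \1_A tau * g (M n tau) (Z n tau))%R]%E =
    (\sum_(i < l.+1) \sum_(a < i.+1) c i a * mixed_moment P l n A i a)%:E.
  transitivity (\sum_(i < l.+1) \sum_(a < i.+1) c' i a * mixed_moment P l n A i a)%:E.
    rewrite -(expectation_mixed hP hp hl hq n (Fn_measurable FA) c'0); congr expectation.
    apply/funext => tau; rewrite gE; congr (_ * _); apply: eq_bigr => i _.
    by apply: eq_bigr => a _; rewrite /c' -ltnS ltn_ord.
  by congr EFin; apply: eq_bigr => i _; apply: eq_bigr => a _; rewrite /c' -ltnS ltn_ord.
(* The denominator lives at time n + k but is measured at the scale of time k; rho is the ratio of
   the two scales. *)
have den : (N (n + k)%N)`_l / (lam k ^+ l * kap k) @[k --> \oo] --> Y`_l * rho.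
  rewrite (_ : (fun k => _) = fun k => (N (n + k)%N)`_l / (lam (n + k)%N ^+ l * kap (n + k)%N) *
     (lam (n + k)%N ^+ l * kap (n + k)%N / (lam k ^+ l * kap k))).
    apply: cvgM => //; have := hN l (leqnn l); rewrite /scaled_cvg -(cvg_shiftn n).
    by under eq_fun do rewrite addnC.
  by apply/funext => k; rewrite mulrA divfK// gt_eqF.
have den0 : 0 < Y`_l * rho by exact: mulr_gt0.
have num : \sum_(i < l.+1) \sum_(a < i.+1) ((N k ^+ a)`_i / (l - i)`!%:R) *
     mixed_moment P l n A i a / (lam k ^+ l * kap k) @[k --> \oo] -->
   \sum_(i < l.+1) \sum_(a < i.+1) (Y ^+ a)`_i * gam i a / (l - i)`!%:R *
     mixed_moment P l n A i a.
  apply: cvg_sumr => i _; apply: cvg_sumr => a _.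
  have il : (i <= l)%N by rewrite -ltnS.
  have ai : (a <= i)%N by rewrite -ltnS.
  have [ia0|ia] := boolP ((a == 0 :> nat) ==> (i == 0 :> nat)); last first.
    move: ia; rewrite negb_imply => /andP[/eqP a0 /negbTE i0].
    rewrite a0 expr0 coef1 i0 !mul0r (_ : (fun k => _) = cst 0); first exact: cvg_cst.
    by apply/funext => k; rewrite mul0r.
  rewrite (_ : (fun k => _) = fun k => (N k ^+ a)`_i / (lam k ^+ i * kap k ^+ a) *
    (lam k ^+ i * kap k ^+ a / (lam k ^+ l * kap k)) / (l - i)`!%:R * mixed_moment P l n A i a).
    do 2 apply: cvgMr_tmp; apply: cvgM; first exact: (scaled_cvgX hN il).
    by apply: hgam => //; rewrite ai.
  apply/funext => k; field.
  by rewrite !expf_neq0 ?gt_eqF.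
apply: (@cvg_trans _ (((\sum_(i < l.+1) \sum_(a < i.+1) ((N k ^+ a)`_i / (l - i)`!%:R) *
     mixed_moment P l n A i a / (lam k ^+ l * kap k)) /
     ((N (n + k)%N)`_l / (lam k ^+ l * kap k)))%:E @[k --> \oo])).
  (* The identity is only eventual: the denominator can vanish, as it does when n + k = 0, but not
     for large k since its normalized limit is positive. *)
  apply: near_eq_cvg; near=> k.
  have Nl0 : (N (n + k)%N)`_l != 0.
    have : 0 < (N (n + k)%N)`_l / (lam k ^+ l * kap k) by near: k; exact: (cvgr_gt _ den).
    by rewrite pmulr_lgt0 ?invr_gt0// => /gt_eqF ->.
  rewrite /penalized_ratio (expectation_indic_moment hP hp hl hq _ FA)
    (Mmoment_poly hP hp hl hq _ (leqnn l)).
  have -> : (moment_poly p q l (n + k)%N)`_l = (N (n + k)%N)`_l.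
    by rewrite coefB coef1 gtn_eqF// subr0.
  rewrite inver mulf_eq0 (negbTE (f0 _)) (negbTE Nl0) /= -EFinM; congr EFin.
  under eq_bigr => i _ do rewrite -mulr_suml.
  rewrite -mulr_suml; field.
  by rewrite Nl0 f0 gt_eqF ?expf_neq0 ?gt_eqF.
apply: cvg_EFin; first by near=> k.
rewrite [X in _ --> X](_ : _ = (\sum_(i < l.+1) \sum_(a < i.+1)
  (Y ^+ a)`_i * gam i a / (l - i)`!%:R *
     mixed_moment P l n A i a) / (Y`_l * rho)).
  by apply: cvgM => //; apply: cvgV => //; rewrite gt_eqF.
rewrite mulr_suml; apply: eq_bigr => i _; rewrite mulr_suml; apply: eq_bigr => a _.
by rewrite mulrAC.
Unshelve. all: by end_near. Qed.

End ratio.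

(** * Identification of the limiting densities *)

Lemma coef_exp_ffun (R : realType) (Y : {poly R}) (z i : nat) :
  (Y ^+ z)`_i = \sum_(t : {ffun 'I_z -> 'I_i.+1} | (\sum_(j < z) t j == i)%N)
    \prod_(j < z) Y`_(t j).
Proof.
(* Only degrees up to i matter, and truncating there gives each factor the finite index type over
   which [bigA_distr_bigA] expands the product. *)
have trunc (Q : {poly R}) k : (k <= i)%N ->
   (Q ^+ z)`_k = ((\poly_(j < i.+1) Q`_j) ^+ z)`_k.
  elim: z k => [//|z IH] k ki; rewrite !exprS !coefM; apply: eq_bigr => j _.
  have ji : (j <= i)%N by rewrite (leq_trans _ ki)// -ltnS.
  by rewrite coef_poly ltnS ji IH// (leq_trans (leq_subr _ _)).
rewrite trunc// poly_def -[z in LHS]card_ord -prodr_const bigA_distr_bigA /= coef_sum.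
rewrite [RHS]big_mkcond; apply: eq_bigr => t _.
under eq_bigr do rewrite -mul_polyC.
rewrite big_split /= -rmorph_prod /= coefCM -expr_sum coefXn eq_sym.
by case: eqP => _; rewrite ?mulr1 ?mulr0.
Qed.

Lemma prod_subr_binomial (R : realType) (z a : nat) :
  \prod_(b < a) (z%:R - b%:R) = ('C(z, a) * a`!)%:R :> R.
Proof.
rewrite bin_ffact; elim: a => [|a IH]; first by rewrite big_ord0.
rewrite big_ord_recr /= IH ffactnSr natrM; have [az|za] := leqP a z.
  by rewrite natrB.
by rewrite ffact_small// !mul0r.
Qed.

Lemma coef_exp_binomial (R : realType) (Y : {poly R}) (z i : nat) : Y`_0 = 0 ->
  ((1 + Y) ^+ z)`_i = \sum_(a < i.+1) (Y ^+ a)`_i * 'C(z, a)%:R.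
Proof.
move=> Y0; rewrite -[_ ^+ z]mul1r (@coefM_exp_binomial _ 1 _ z i i) ?leqnn//.
  apply: eq_bigr => a _; rewrite mul1r mulrC.
  by rewrite (_ : 1 + Y - 1 = Y)// addrC addKr.
by rewrite coefD coef1 Y0 addr0.
Qed.

Section f_formula.
Context (R : realType) (P : probability mtree_space R) (l : nat) (Y : {poly R}).
Hypothesis (Y0 : Y`_0 = 0) (xiE : forall j, (j <= l)%N -> xi P j = j`!%:R * (1 + Y)`_j)
  (Yl : Y`_l != 0) (l_gt0 : (0 < l)%N).

(** As xi_j / j! is the coefficient of degree j of 1 + Y, the multinomial sum is i! times the
    coefficient of degree i of (1 + Y)^z, which expands along binomial(z, a). The factorials combine
    through binomial(l, i) i! / l! = 1 / (l-i)!. *)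
Lemma f_coefE s z : f P l s z = \sum_(i < l.+1) \sum_(a < i.+1)
  (Y ^+ a)`_i / (l - i)`!%:R / Y`_l * (s%:R ^+ (l - i) * 'C(z, a)%:R).
Proof.
have f0 j : j`!%:R != 0 :> R by rewrite pnatr_eq0 -lt0n fact_gt0.
rewrite /f mulr_sumr; apply: eq_bigr => i _; have il : (i <= l)%N by rewrite -ltnS.
transitivity ((xi P l)^-1 * ('C(l, i)%:R * s%:R ^+ (l - i) * (i`!%:R * ((1 + Y) ^+ z)`_i))).
  congr (_ * (_ * _)); rewrite coef_exp_ffun mulr_sumr; apply: eq_bigr => t _.
  rewrite /multinomial -mulrA; congr (_ * _).
  have -> : \prod_(j < z) xi P (t j) =
      (\prod_(j < z) (t j)`!%:R) * \prod_(j < z) (1 + Y)`_(t j).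
    by rewrite -big_split; apply: eq_bigr => j _; rewrite xiE// (leq_trans _ il)// -ltnS.
  rewrite mulKf//.
  by apply/prodf_neq0 => j _.
rewrite xiE// coef_exp_binomial// coefD coef1 gtn_eqF// add0r -(bin_fact il) !natrM.
rewrite !mulr_sumr; apply: eq_bigr => a _; field.
by rewrite !f0 Yl pnatr_eq0 -lt0n bin_gt0 il.
Qed.

End f_formula.

(** Each of the a factors must contribute degree exactly 1. This shows that the limiting polynomial
    has degree exactly l. *)
Lemma coef_exp_diag (R : realType) (Y : {poly R}) a : Y`_0 = 0 -> (Y ^+ a)`_a = Y`_1 ^+ a.
Proof.
move=> Y0; elim: a => [|a IH]; first by rewrite !expr0 coef1.
rewrite !exprS coefM big_ord_recl big_ord_recl /= Y0 mul0r add0r subSS subn0 IH big1 ?addr0//.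
move=> i _; rewrite coef_exp_lt ?mulr0//= /bump /= !add1n subSS.
by rewrite ltn_subrL /= (leq_ltn_trans (leq0n i) (ltn_ord i)).
Qed.

Theorem theorem1p1 (R : realType) (l : nat) (p q : nat -> R) (mu : R)
  (l_gt0 : (0 < l)%N)
  (hp : offspring_distribution p)
  (p01 : p 0%N + p 1%N < 1)
  (hmu : moment p 1 = mu%:E)
  (hl : (moment p l < +oo)%E)
  (hq : mark_function q)
  (hpq : exists k, 0 < p k * q k) :
  [/\ mu < 1 ->
        forall P : probability mtree_space R, marked_GW p q P ->
        (forall j, (j <= l)%N -> Mmoment P j n @[n --> \oo] --> (xi P j)%:E) /\
        forall (n : nat) (A : set mtree_space), Fn n A ->
          penalized_ratio P l n A k @[k --> \oo] -->
            ('E_P[(fun tau => \1_A tau * f P l (M n tau) (Z n tau))%R])%E,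
      mu = 1 ->
        forall P : probability mtree_space R, marked_GW p q P ->
        forall (n : nat) (A : set mtree_space), Fn n A ->
          penalized_ratio P l n A k @[k --> \oo] -->
            ('E_P[(fun tau => \1_A tau * (Z n tau)%:R)%R])%E
    & 1 < mu ->
        exists Pl : {poly R}, size Pl = l.+1 /\
        forall P : probability mtree_space R, marked_GW p q P ->
        forall (n : nat) (A : set mtree_space), Fn n A ->
          penalized_ratio P l n A k @[k --> \oo] -->
            ('E_P[(fun tau => \1_A tau * (Pl.[(Z n tau)%:R] / mu ^+ (l * n)))%R])%E ].

Proof.
have f0 j : j`!%:R != 0 :> R by rewrite pnatr_eq0 -lt0n fact_gt0.
split=> [mu1|mu1|mu1].
- move=> P hP; have lim := subcritical_limit hp hl hq hmu hpq l_gt0 mu1.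
  set Y := scaled_limit _ _ _ _ _ in lim.
  have Y0 : Y`_0 = 0 by have [] := scaled_limit0 hp hl hq (fun=> 1) (fun=> 1).
  have momc j : (j <= l)%N -> Mmoment P j n @[n --> \oo] --> (j`!%:R * (1 + Y)`_j)%:E.
    move=> jl; have [c _] := lim j jl.
    rewrite (_ : Mmoment P j = fun k =>
        (j`!%:R * (1 + (moment_poly p q l k - 1))`_j)%:E); last first.
      by apply/funext => k; rewrite (Mmoment_poly hP hp hl hq _ jl) subrKC.
    apply: cvg_EFin; first by near=> k.
    apply: cvgMl_tmp; rewrite coefD; under eq_fun do rewrite coefD.
    apply: cvgD; first exact: cvg_cst.
    by move: c; rewrite /scaled_cvg; under eq_fun do rewrite expr1n mulr1 divr1.
  have xiE j : (j <= l)%N -> xi P j = j`!%:R * (1 + Y)`_j.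
    by move=> jl; rewrite /xi (cvg_lim (@ereal_hausdorff R) (momc j jl)).
  split=> [j jl|n A FA]; first by rewrite xiE//; exact: momc.
  have [_ /(_ l_gt0) Yl] := lim l (leqnn l).
  (* All scales are 1, so no term of the double sum disappears. *)
  apply: (@penalized_ratio_cvg _ p q l hp hl hq l_gt0 P hP
    (fun=> 1) (fun=> 1) 1 (fun _ _ => 1) Y _ n A) => //.
  + by move=> i il; have [] := lim i il.
  + by rewrite expr1n mulr1 divr1; exact: cvg_cst.
  + by move=> i a _ _; rewrite !expr1n mulr1 divr1; exact: cvg_cst.
  + move=> m z; rewrite (f_coefE Y0 xiE)// ?gt_eqF//.
    by apply: eq_bigr => i _; apply: eq_bigr => a _; rewrite !mulr1.
- move=> P hP n A FA; have lim := critical_limit hp hl hq p01 hmu hpq l_gt0 mu1.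
  set Y := scaled_limit _ _ _ _ _ in lim.
  have [_ /(_ l_gt0) Yl] := lim l (leqnn l).
  have kn0 k : (k.+1%:R : R) != 0 by [].
  apply: (@penalized_ratio_cvg _ p q l hp hl hq l_gt0 P hP (fun k => k.+1%:R ^+ 2) harmonic 1
    (fun i a => ((i == l) && (a == 1%N))%:R) Y (fun _ z => z%:R) n A) => //.
  + by move=> k; rewrite /harmonic /=.
  + by move=> i il; have [] := lim i il.
  (* The scale in degree l is (k+1)^(2l-1), and (n+k+1)/(k+1) = 1 + n/(k+1) tends to 1. *)
  + rewrite (_ : (fun k => _) = fun k => (1 + n%:R * harmonic k) ^+ (l.*2.-1)).
      rewrite [X in _ --> X](_ : 1 = (1 + n%:R * 0) ^+ (l.*2.-1)); last first.
        by rewrite mulr0 addr0 expr1n.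
      apply: cvg_exprn; apply: cvgD; first exact: cvg_cst.
      by apply: cvgMl_tmp; exact: cvg_harmonic.
    have sc k : (k.+1%:R ^+ 2) ^+ l * harmonic k = k.+1%:R ^+ l.*2.-1 :> R.
      rewrite -exprM mul2n -[l.*2 in LHS](@prednK _ _) ?double_gt0// exprSr /harmonic /=.
      by rewrite mulfK.
    apply/funext => k; rewrite !sc -expr_div_n -addnS natrD mulrDl divff// addrC.
    by [].
  (* The scales have exponents 2i - a and 2l - 1, with difference e. The truncated subtraction is
     exact because i = l with a = 0 is excluded, and e = 0 only for i = l, a = 1. *)
  + move=> i a /andP[ai il] ia; set e := (l.*2 + a - i.*2.+1)%N.
    have eE : (e + i.*2.+1 = l.*2 + a)%N by move: ia; rewrite /e; case: eqP => /=; lia.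
    rewrite (_ : (fun k => _) = fun k => harmonic k ^+ e); last first.
      apply/funext => k; rewrite /harmonic /= -!exprM !mul2n !exprVn invfM invrK mulrA.
      have Ke : (k.+1%:R : R) ^+ e * k.+1%:R ^+ i.*2.+1 = k.+1%:R ^+ l.*2 * k.+1%:R ^+ a.
        by rewrite -!exprD eE.
      have -> : (k.+1%:R : R) ^+ e = k.+1%:R ^+ l.*2 * k.+1%:R ^+ a / k.+1%:R ^+ i.*2.+1.
        by rewrite -Ke mulfK ?expf_neq0.
      rewrite exprS; move: (kn0 k); move: (k.+1%:R : R) => K K0; field.
      by rewrite K0 !expf_neq0.
    rewrite (_ : (_ && _)%:R = 0 ^+ e :> R); first by apply: cvg_exprn; exact: cvg_harmonic.
    rewrite expr0n; congr ((nat_of_bool _)%:R); apply/idP/idP.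
      by move=> /andP[/eqP iE /eqP aE]; apply/eqP; move: eE; rewrite iE aE; lia.
    by move=> /eqP e0; apply/andP; split; apply/eqP; move: eE; rewrite e0; lia.
  + move=> m z; rewrite (bigD1 ord_max)//= (bigD1 (Ordinal (l_gt0 : (1 < l.+1)%N)))//=.
    rewrite !big1 ?addr0//.
    * by rewrite !eqxx expr1 subnn fact0 expr0 bin1 mul1r divr1 !mulr1 divff ?mul1r ?gt_eqF.
    * by move=> i; rewrite -val_eqE /= => /negbTE ->; rewrite big1// => a _; rewrite mulr0 !mul0r.
    * by move=> a; rewrite -val_eqE /= => /negbTE ->; rewrite andbF mulr0 !mul0r.
- have lim := supercritical_limit hp hl hq p01 hmu hpq l_gt0 mu1.
  set Y := scaled_limit _ _ _ _ _ in lim.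
  have mu0 : 0 < mu by exact: lt_trans mu1.
  have imu : `|mu^-1| < 1 by rewrite ger0_norm ?invr_ge0 ?ltW// invf_lt1.
  have Y0 : Y`_0 = 0 by have [] := scaled_limit0 hp hl hq (fun k => mu ^+ k) (fun=> 1).
  have [_ /(_ l_gt0) Yl] := lim l (leqnn l).
  have [_ /(_ isT) Y1] := lim 1%N l_gt0.
  (* The falling factorial, equal to a! binomial(z, a) at z, turns the binomials into polynomials of
     degree a. As Y is built from p, q and l alone, the polynomial can be chosen before P. *)
  pose b a : {poly R} := \prod_(i < a) ('X - (i%:R)%:P).
  have sb a : size (b a) = a.+1.
    by rewrite /b size_prod_XsubC /index_enum -enumT size_enum_ord.
  pose c a := (Y ^+ a)`_l / Y`_l / a`!%:R.
  have cl : c l != 0.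
    by rewrite /c coef_exp_diag// gt_eqF// !divr_gt0 ?exprn_gt0// ltr0n fact_gt0.
  exists (\sum_(a < l.+1) c a *: b a); split.
    rewrite big_ord_recr /= addrC size_polyDl size_scale ?sb//.
    rewrite ltnS; apply: (leq_trans (size_sum _ _ _)); apply/bigmax_leqP => a _.
    by rewrite (leq_trans (size_scale_leq _ _))// sb.
  move=> P hP n A FA.
  (* Only i = l survives, the other terms decaying like mu^(-k(l-i)), so M_n disappears; the factor
     mu^(ln) is the ratio of the scales at times n + k and k. *)
  apply: (@penalized_ratio_cvg _ p q l hp hl hq l_gt0 P hP
    (fun k => mu ^+ k) (fun=> 1) (mu ^+ (l * n)) (fun i a => (i == l)%:R) Y
    (fun _ z => (\sum_(a < l.+1) c a *: b a).[z%:R] / mu ^+ (l * n)) n A) => //.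
  + by move=> k; rewrite exprn_gt0.
  + by rewrite exprn_gt0.
  + by move=> i il; have [] := lim i il.
  + rewrite (_ : (fun k => _) = cst (mu ^+ (l * n))); first exact: cvg_cst.
    apply/funext => k; rewrite !mulr1 exprD exprMn mulfK ?expf_neq0 ?gt_eqF//.
    by rewrite -exprM mulnC.
  + move=> i a /andP[ai il] _.
    rewrite (_ : (fun k => _) = fun k => (mu^-1 ^+ k) ^+ (l - i)); last first.
      apply/funext => k; rewrite expr1n !mulr1 !exprVn -[in X in _ / X](subnK il) exprD.
      by rewrite invfM mulrCA divff ?mulr1// !expf_neq0// gt_eqF.
    rewrite (_ : (i == l)%:R = 0 ^+ (l - i) :> R).
      by apply: cvg_exprn; exact: cvg_expr.
    by rewrite expr0n subn_eq0 eqn_leq il.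
  + move=> m z; rewrite horner_sum mulr_suml [RHS]big_ord_recr /=.
    rewrite [X in _ = X + _]big1 ?add0r; last first.
      by move=> i _; rewrite big1// => a _; rewrite ltn_eqF// mulr0 !mul0r.
    apply: eq_bigr => a _; rewrite eqxx subnn fact0 expr0 hornerZ horner_prod.
    under eq_bigr do rewrite hornerXsubC.
    rewrite prod_subr_binomial natrM /c (_ : true%:R = 1 :> R)//.
    by field; rewrite f0 expf_neq0 ?gt_eqF.
Unshelve. all: by end_near. Qed.
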